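(* Let $C_1,\dots,C_d$ be standard Cauchy processes and $B$ a standard one-dimensional Brownian motion, all mutually independent. The joint probability law of the vector process $\big(C_1(|B(t)|),\dots,C_d(|B(t)|)\big)$, $t>0$, reads $$p_{CB}^d(x_1,\dots,x_d,t)=\frac{2}{\pi^d}\int_0^{+\infty}\prod_{j=1}^d\frac{s}{s^2+x_j^2}\,\frac{e^{-\frac{s^2}{2t}}}{\sqrt{2\pi t}}\,ds$$ and satisfies, for $d>1$, the fractional equation $$\frac{\partial p}{\partial t}=2\sum_{k=2}^d\sum_{j=1}^{k-1}\frac{\partial^2p}{\partial|x_k|\,\partial|x_j|}-\sum_{k=1}^d\frac{\partial^2p}{\partial x_k^2},\qquad x_j\in\mathbb{R},\ j=1,\dots,d,\ t>0,$$ with initial condition $p(x_1,\dots,x_d,0)=\prod_{j=1}^d\delta(x_j)$.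
   Context: $\delta$ is the Dirac delta function. The Cauchy process $C_j(s)$ has density $\frac{s}{\pi(s^2+x^2)}$. $\frac{\partial}{\partial|x|}$ denotes the first-order Riesz fractional derivative $$\frac{\partial}{\partial|x|}f(x)=-\frac1\pi\int_0^{+\infty}\frac{f(x-y)-2f(x)+f(x+y)}{y^2}\,dy,$$ equivalently $\frac{\partial}{\partial|x|}f(x)=\frac1\pi\frac{d}{dx}\left[\int_{-\infty}^x\frac{f(y)}{x-y}dy-\int_x^\infty\frac{f(y)}{y-x}dy\right]$, whose Fourier transform is $\int_{-\infty}^{+\infty}e^{i\beta x}\frac{\partial}{\partial|x|}f(x)\,dx=|\beta|\int_{-\infty}^{+\infty}e^{i\beta x}f(x)\,dx$ (with this sign convention the Cauchy density $p_C(x,s)=\frac{s}{\pi(s^2+x^2)}$ satisfies $\frac{\partial}{\partial s}p_C=-\frac{\partial}{\partial|x|}p_C$). For a function of several variables, $\frac{\partial}{\partial|x_j|}$ acts on the variable $x_j$, and $\frac{\partial^2}{\partial|x_k|\partial|x_j|}$ is the composition of $\frac{\partial}{\partial|x_k|}$ and $\frac{\partial}{\partial|x_j|}$.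
   Formalization: The right side of the equation carries a factor 1/2, since the Gaussian kernel satisfies g_t = g_ss/2 (as printed the equation is off by a factor 2), and the equation is asserted at points with all x_j ≠ 0, because p or its derivatives are singular on coordinate hyperplanes. *)

(* Defs.v *)
From HB Require Import structures.
From mathcomp Require Import all_boot all_order all_algebra.
From mathcomp Require Import all_classical all_reals all_analysis.
Set Implicit Arguments.
Unset Strict Implicit.
Unset Printing Implicit Defensive.
Import Order.TTheory GRing.Theory Num.Theory.
Import numFieldNormedType.Exports.
Local Open Scope classical_set_scope.
Local Open Scope ring_scope.

Section Processes.
Context {dOm : measure_display} {Om : measurableType dOm} {R : realType}.
Variable P : probability Om R.

Definition mutually_independent (I : finType) (F : I -> set (set Om)) : Prop :=
  forall (J : {set I}) (E : I -> set Om), (forall i, i \in J -> F i (E i)) ->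
    P (\big[setI/setT]_(i in J) E i) = (\prod_(i in J) P (E i))%E.

(* A process is a map X : R -> Om -> R of which only the times t >= 0 are
   meaningful: its values at negative times are never used. *)
Definition process_sigma_algebra (X : R -> Om -> R) : set (set Om) :=
  <<s \bigcup_(t in `[0, +oo[) preimage_set_system setT (X t) measurable >>.

Definition measurable_process (X : R -> Om -> R) : Prop :=
  forall t, 0 <= t -> measurable_fun setT (X t).

Definition increment (X : R -> Om -> R) (s t : R) : Om -> R :=
  fun w => X t w - X s w.

Definition independent_increments (X : R -> Om -> R) : Prop :=
  forall (n : nat) (tau : nat -> R), 0 <= tau 0%N ->
    {homo tau : i j / (i <= j)%N >-> i <= j} ->
    mutually_independent (fun i : 'I_n =>
      preimage_set_system setT (increment X (tau i) (tau i.+1)) measurable).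

Definition cauchy_pdf (s x : R) : R := s / (pi * (s ^+ 2 + x ^+ 2)).

Definition cauchy_prob (s : R) (A : set R) : \bar R :=
  (\int[lebesgue_measure]_(x in A) (cauchy_pdf s x)%:E)%E.

Definition cadlag (f : R -> R) : Prop :=
  (forall t, 0 <= t -> f x @[x --> t^'+] --> f t) /\
  (forall t, 0 < t -> cvg (f x @[x --> t^'-])).

Definition standard_cauchy_process (X : R -> Om -> R) : Prop :=
  [/\ measurable_process X,
      {ae P, forall w, X 0 w = 0},
      independent_increments X,
      (forall s t, 0 <= s -> s < t -> forall A : set R, measurable A ->
         P (increment X s t @^-1` A) = cauchy_prob (t - s) A) &
      forall w, cadlag (X ^~ w)].

(* The second parameter of normal_prob is the standard deviation. *)
Definition standard_brownian_motion (X : R -> Om -> R) : Prop :=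
  [/\ measurable_process X,
      {ae P, forall w, X 0 w = 0},
      independent_increments X,
      (forall s t, 0 <= s -> s < t -> forall A : set R, measurable A ->
         P (increment X s t @^-1` A) = normal_prob 0 (Num.sqrt (t - s)) A) &
      forall w, {within `[0, +oo[, continuous (X ^~ w)}].

Definition independent_processes (I : finType) (X : I -> R -> Om -> R) : Prop :=
  mutually_independent (fun i => process_sigma_algebra (X i)).

(* Iterated integral over R^n, first coordinate outermost; by Fubini-Tonelli it
   is the Lebesgue integral on R^n for nonnegative Borel or integrable f. *)
Fixpoint rv_integral (n : nat) : ('rV[R]_n -> \bar R) -> \bar R :=
  match n with
  | 0 => fun f => f 0
  | m.+1 => fun f => (\int[lebesgue_measure]_x
      rv_integral (fun v : 'rV[R]_m => f (row_mx (x%:M : 'rV[R]_1) v)))%E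
  end.

Definition has_density (n : nat) (X : Om -> 'rV[R]_n) (f : 'rV[R]_n -> R) : Prop :=
  forall A : set 'rV[R]_n, <<s open >> A ->
    measurable (X @^-1` A) /\
    P (X @^-1` A) = rv_integral (fun x => (\1_A x * f x)%:E).

End Processes.

Section FractionalDerivatives.
Context {R : realType}.

Definition riesz_integrand (f : R -> R) (x y : R) : R :=
  (f (x - y) - 2 * f x + f (x + y)) / y ^+ 2.

(* Rintegral returns a value also when the integral diverges. *)
Definition riesz_derivable (f : R -> R) (x : R) : Prop :=
  lebesgue_measure.-integrable `]0, +oo[ (EFin \o riesz_integrand f x).

Definition riesz_derivative (f : R -> R) (x : R) : R :=
  - pi^-1 * \int[lebesgue_measure]_(y in `]0, +oo[) riesz_integrand f x y.

Definition twice_derivable (f : R -> R) (x : R) : Prop :=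
  (\forall y \near x, derivable f y 1) /\ derivable (derive1 f) x 1.

Context {d : nat}.
Implicit Types (f : 'rV[R]_d -> R) (x : 'rV[R]_d) (k : 'I_d).

Definition set_coord x k (y : R) : 'rV[R]_d :=
  \row_i (if i == k then y else x 0 i).

Definition along f k x : R -> R := fun y => f (set_coord x k y).

Definition partial_riesz k f : 'rV[R]_d -> R :=
  fun x => riesz_derivative (along f k x) (x 0 k).

Definition partial2 k f : 'rV[R]_d -> R :=
  fun x => derive1n 2 (along f k x) (x 0 k).

Definition p_CB x (t : R) : R :=
  2 / pi ^+ d * \int[lebesgue_measure]_(s in `]0, +oo[)
    ((\prod_(j < d) (s / (s ^+ 2 + x 0 j ^+ 2))) *
     (expR (- (s ^+ 2 / (2 * t))) / Num.sqrt (2 * pi * t))).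

End FractionalDerivatives.

(* Main.v *)
(* Conditionally on B(t), independence of the processes makes the coordinates
   C_j(|B(t)|) independent Cauchy variables of scale |B(t)|; integrating against
   the even law of B(t) gives the density p_CB as a mixture, over s > 0, of the
   products Q(s) = prod_j s / (s^2 + x_j^2) with weight the Gaussian g_t(s).

   For the equation, let q(s, x) = s / (s^2 + x^2) with x <> 0. An explicit
   antiderivative gives d/d|x| q = - d/ds q, and q is harmonic, so
   d^2/dx^2 q = - d^2/ds^2 q; both operators pass under the integral in s. Hence
   d^2/d|x_k|d|x_j| and - d^2/dx_k^2 produce, respectively, the terms
   (d_s q_k)(d_s q_j) and d_s^2 q_k of the second derivative Q''. Conversely
   d/dt g_t = g_t'' / 2, and two integrations by parts in s move the two
   derivatives onto Q; the boundary terms at s = 0 vanish because Q(0) = 0 and,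
   as soon as d >= 2, Q'(0) = 0.

   The initial condition is dominated convergence along the paths: as t decreases
   to 0, C_j(|B(t)|) converges to C_j(0) = 0 since C_j is right-continuous. *)
Require Import Defs.
From HB Require Import structures.
From mathcomp Require Import all_boot all_order all_algebra.
From mathcomp Require Import all_classical all_reals all_analysis.
From mathcomp Require Import measurable_realfun.
From mathcomp Require Import ring lra zify.
Import Order.TTheory GRing.Theory Num.Theory.
Import numFieldNormedType.Exports.
Local Open Scope classical_set_scope.
Local Open Scope ring_scope.

Set Implicit Arguments.
Unset Strict Implicit.
Unset Printing Implicit Defensive.

(** * Borel sets and iterated integrals on R^n *)

(** Three obstacles shape the proof. [rv_integral] is a bare iterated integral, so it is first
    identified with integration against a sigma-finite measure on Borel rows, where Tonelli, Fubini
    and null sets are available. Conditioning on B(t) evaluates each C_j at a random time: this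
    needs joint measurability in time and outcome, and for the sigma-algebra generated by the C_j
    alone, because independence from B is known only there. Finally [p_CB] is a real-valued integral
    that may diverge on the hyperplanes x_j = 0, where it takes a default value; the formulas for it
    are therefore obtained off these sets, which are null. Along one coordinate this leaves a
    function known off 0 only, which costs one point, y = |x|, in each Riesz integral. The kernel
    bounds are uniform in s and are powers of 1/|x|: this uniformity, rather than decay in s,
    justifies the exchanges with the mixture, the weight in s being integrable by itself. *)

Notation borel_row R n := (g_sigma_algebraType (@open 'rV[R]_n)).

Section sigma_finite_copy.
Context d (T : measurableType d) (R : realType).
Variables (m : {measure set T -> \bar R}) (sf : sigma_finite setT m).

(* An alias carrying the sigma-finiteness instance that the proof [sf] provides. *)
Definition sigma_finite_copy of sigma_finite setT m : set T -> \bar R := m.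

HB.instance Definition _ := Measure.copy (sigma_finite_copy sf) m.
HB.instance Definition _ :=
  Measure_isSigmaFinite.Build _ _ _ (sigma_finite_copy sf) sf.

End sigma_finite_copy.

Section borel_row.
Context {R : realType}.

Lemma continuous_measurable_row n (f : 'rV[R]_n -> R) :
  continuous f -> measurable_fun setT (f : borel_row R n -> R).
Proof.
move=> cf; apply: (measurability _ (RGenOpens.measurableE R)).
move=> _ [_ [a [b ->]] <-]; rewrite setTI.
by apply: sub_sigma_algebra; move/continuousP: cf; apply; exact: itv_open.
Qed.

Lemma measurable_coord n (j : 'I_n) :
  measurable_fun setT (fun x : borel_row R n => x 0 j).
Proof. by apply: continuous_measurable_row; exact: coord_continuous. Qed.

(** Borel sets of rows are generated by open sets, not by coordinates; the two sigma-algebras agree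
    because R^n is second countable. *)
Lemma measurable_row d (T : measurableType d) n (f : T -> borel_row R n) :
  (forall j, measurable_fun setT (fun x => f x 0 j)) -> measurable_fun setT f.
Proof.
have mE : (measurable : set (set (borel_row R n))) = <<s @open 'rV[R]_n >> by [].
move=> mf; apply: (measurability _ mE) => _ [U oU <-].
rewrite setTI.
(* Open sets are countable unions of boxes with rational centers. *)
pose box (i : 'rV[rat]_n * nat) : set 'rV[R]_n :=
  [set x | forall j, `|x 0 j - ratr (i.1 0 j)| < i.2.+1%:R^-1].
have -> : U = \bigcup_i [set x | box i x /\ box i `<=` U].
  apply/seteqP; split=> [x Ux|x [i _ [bx]]]; last exact.
  have /nbhs_ballP[e /= e0 xeU] : nbhs x U by exact: open_nbhs_nbhs.
  (* Half of the radius, because a point of the box is reached from x in two hops, through the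
     rational center. *)
  have [m me] : exists m : nat, m.+1%:R^-1 < e / 2.
    near \oo => m; exists m; near: m.
    have e20 : 0 < e / 2 by rewrite divr_gt0.
    exact: (near_infty_natSinv_lt (PosNum e20)).
  have m0 : 0 < m.+1%:R^-1 :> R by rewrite invr_gt0.
  have /(_ _)/cid-/all_sig[q qx] j :
      exists q : rat, ratr q \in `]x 0 j - m.+1%:R^-1, x 0 j + m.+1%:R^-1[.
    by apply: rat_in_itvoo; rewrite ltrBlDr -addrA ltrDl addr_gt0.
  have xq j : `|x 0 j - ratr (q j)| < m.+1%:R^-1.
    by rewrite distrC ltr_distl; have := qx j; rewrite in_itv.
  exists (\row_j q j, m) => //; split=> [j /=|y ybox]; first by rewrite mxE.
  apply: xeU; split=> // i j; rewrite ord1.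
  have := ybox j; rewrite /= mxE => yq; have := xq j.
  rewrite /ball /= => {}xq.
  rewrite -(subrK (ratr (q j)) (x 0 j)) -addrA.
  rewrite (le_lt_trans (ler_normD _ _))// (distrC (ratr _)).
  by rewrite [ltRHS]splitr ltrD// (lt_trans _ me).
rewrite preimage_bigcup; apply: countable_bigcupT_measurable => // i.
have [biU|nbiU] := pselect (box i `<=` U); last first.
  rewrite [X in measurable X](_ : _ = set0)//.
  by apply/seteqP; split=> // x [].
rewrite [X in measurable X](_ : _ =
  \bigcap_j (fun x => `|f x 0 j - ratr (i.1 0 j)|) @^-1` `]-oo, i.2.+1%:R^-1[).
  apply: fin_bigcap_measurable; first exact: finite_finset.
  move=> j _; rewrite -[X in measurable X]setTI.
  apply: (@measurableT_comp _ _ _ _ _ _ (@Num.norm R R)) => //.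
  exact: measurable_funB.
apply/seteqP; split=> x /=; first by move=> [bx _] j _ /=; rewrite in_itv/=; exact: bx.
by move=> bx; split=> // j; have := bx j I; rewrite /= in_itv.
Unshelve. all: end_near. Qed.

(** The gluing inside [rv_integral], as a map on the product space along which a measure can be
    pushed forward. *)
Definition cons_row n (z : R * borel_row R n) : borel_row R n.+1 :=
  row_mx (z.1%:M : 'rV[R]_1) z.2.

Lemma cons_row0 n (z : R * borel_row R n) : cons_row z 0 ord0 = z.1.
Proof.
transitivity (row_mx (z.1%:M : 'rV[R]_1) (z.2 : 'rV[R]_n) 0 (lshift n 0)).
  by congr (row_mx _ _ _ _); exact: val_inj.
by rewrite row_mxEl mxE eqxx mulr1n.
Qed.

Lemma cons_rowS n (z : R * borel_row R n) (j : 'I_n) :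
  cons_row z 0 (lift ord0 j) = z.2 0 j.
Proof.
transitivity (row_mx (z.1%:M : 'rV[R]_1) (z.2 : 'rV[R]_n) 0 (rshift 1 j)).
  by congr (row_mx _ _ _ _); exact: val_inj.
by rewrite row_mxEr.
Qed.

Lemma measurable_cons_row n : measurable_fun setT (@cons_row n).
Proof.
apply: measurable_row => j; have [i ->|->] := unliftP ord0 j.
- under eq_fun do rewrite cons_rowS.
  by apply: measurableT_comp (measurable_coord i) _; exact: measurable_snd.
- by under eq_fun do rewrite cons_row0; exact: measurable_fst.
Qed.

Definition uncons_row n (x : borel_row R n.+1) : R * borel_row R n :=
  (x 0 ord0, \row_j x 0 (lift ord0 j)).

Lemma cons_rowK n : cancel (@cons_row n) (@uncons_row n).
Proof.
move=> [a v]; rewrite /uncons_row cons_row0; congr pair.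
by apply/rowP => j; rewrite mxE cons_rowS.
Qed.

Lemma measurable_uncons_row n : measurable_fun setT (@uncons_row n).
Proof.
apply: measurable_fun_pair; first exact: measurable_coord.
apply: measurable_row => j; under eq_fun do rewrite mxE.
exact: measurable_coord.
Qed.

Local Open Scope ereal_scope.

(** The parameter space varies in the induction: at each step the outermost coordinate joins the
    parameters. *)
Lemma measurable_rv_integral d (T : measurableType d) n
    (f : T * borel_row R n -> \bar R) : measurable_fun setT f ->
  measurable_fun setT (fun t => rv_integral (fun v => f (t, v))).
Proof.
elim: n => [|n IH] in d T f *.
  by move=> mf /=; apply: (measurableT_comp mf); exact: measurable_pair2.
move=> mf /=.
pose g (z : T * R) := rv_integral (fun v => f (z.1, cons_row (z.2, v))).
have mg : measurable_fun setT g.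
  apply: (IH _ _ (fun z : T * R * borel_row R n =>
    f (z.1.1, cons_row (z.1.2, z.2)))).
  apply: measurableT_comp mf _; apply: measurable_fun_pair.
    by apply: measurableT_comp => //; exact: measurable_fst.
  apply: (measurableT_comp (@measurable_cons_row n)).
  apply: measurable_fun_pair; last exact: measurable_snd.
  by apply: measurableT_comp => //; exact: measurable_snd.
(* Tonelli gives measurability for nonnegative integrands; the general integral is by definition the
   difference of two such integrals. *)
rewrite [X in measurable_fun _ X](_ : _ = fun t =>
  \int[lebesgue_measure]_x g^\+ (t, x) - \int[lebesgue_measure]_x g^\- (t, x)).
  apply: emeasurable_funB.
    apply: (@measurable_fun_fubini_tonelli_F _ _ _ _ _ lebesgue_measure g^\+) => //.
    exact: measurable_funepos.
  apply: (@measurable_fun_fubini_tonelli_F _ _ _ _ _ lebesgue_measure g^\-) => //.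
  exact: measurable_funeneg.
apply/funext => t; rewrite [LHS]integralE.
by congr (_ - _); apply: eq_integral => x _; rewrite ?funeposE ?funenegE.
Qed.

(** Lebesgue measure on rows, built by pushing the product of the line with the previous measure
    along [cons_row]. It is known to the sequel only through these two formulas. *)
Lemma row_lebesgue_measure n :
  exists mu : {sigma_finite_measure set (borel_row R n) -> \bar R},
    (forall f, measurable_fun setT f -> (forall x, 0 <= f x) ->
      \int[mu]_x f x = rv_integral f) /\
    (forall f, mu.-integrable setT f -> \int[mu]_x f x = rv_integral f).
Proof.
elim: n => [|n [mu [mufE muifE]]].
  exists (@dirac _ _ (const_mx 0%R : borel_row R 0) R).
  split=> f; first by move=> mf f0; rewrite integral_dirac// diracT mul1e.
  by move=> /measurable_int mf; rewrite integral_dirac// diracT mul1e.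
pose nu := lebesgue_measure \x mu.
have sf : sigma_finite setT (pushforward nu (@cons_row n)).
  have /sigma_finiteP[F [FT ndF Foo]] := sigma_finiteT (@lebesgue_measure R).
  have /sigma_finiteP[G [GT ndG Goo]] := sigma_finiteT mu.
  exists (fun k => @uncons_row n @^-1` (F k `*` G k)).
    rewrite -preimage_bigcup -[LHS](preimage_setT (@uncons_row n)).
    congr (_ @^-1` _); apply/esym/seteqP; split=> // -[a v] _.
    have [i _ Fi] : (\bigcup_i F i) a by rewrite -FT.
    have [j _ Gj] : (\bigcup_i G i) v by rewrite -GT.
    exists (maxn i j) => //; split.
      by move: a Fi; apply/subsetPset/ndF; exact: leq_maxl.
    by move: v Gj; apply/subsetPset/ndG; exact: leq_maxr.
  move=> k; have [mFk Fkoo] := Foo k; have [mGk Gkoo] := Goo k; split.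
    rewrite -[X in measurable X]setTI.
    by apply: measurable_uncons_row => //; exact: measurableX.
  rewrite /pushforward -comp_preimage (_ : _ \o _ = id); last first.
    by apply/funext => z /=; rewrite cons_rowK.
  by rewrite preimage_id /nu product_measure1E// lte_mul_pinfty// ge0_fin_numE.
have [m mE] : exists m : {measure set (borel_row R n.+1) -> \bar R},
    m = pushforward nu (@cons_row n) :> (set _ -> _).
  unshelve eexists (pushforward nu (@cons_row n)) => //.
  exact: measurable_cons_row.
rewrite -mE in sf.
exists (sigma_finite_copy sf); split=> f.
  move=> mf f0.
  rewrite /sigma_finite_copy mE ge0_integral_pushforward//; last first.
    exact: measurable_cons_row.
  rewrite preimage_setT fubini_tonelli1//=; last first.
    by apply: measurableT_comp => //; exact: measurable_cons_row.
  apply: eq_integral => x _; rewrite /fubini_F/= mufE//.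
  apply: (@measurableT_comp _ _ _ _ _ _ (f \o @cons_row n)).
    by apply: measurableT_comp => //; exact: measurable_cons_row.
  exact: measurable_pair1.
move=> /integrableP[mf]; rewrite /sigma_finite_copy mE => foo.
have mfc : measurable_fun setT (f \o @cons_row n).
  by apply: measurableT_comp => //; exact: measurable_cons_row.
have ifc : nu.-integrable setT (f \o @cons_row n).
  apply/integrableP; split=> //; move: foo.
  rewrite ge0_integral_pushforward//; first exact: measurable_cons_row.
  exact: measurableT_comp.
rewrite integral_pushforward//; last exact: measurable_cons_row.
rewrite preimage_setT -(integral12_prod_meas1 ifc).
(* Integrability on the product makes the sections integrable for almost every x only, so the
   induction hypothesis applies almost everywhere. *)
apply: ae_eq_integral => //.
- exact: (measurable_fubini_F ifc).
- exact: (@measurable_rv_integral _ R n (f \o @cons_row n)).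
- apply: filterS (ae_integrable1 ifc) => x ix _.
  by rewrite /fubini_F muifE.
Qed.

Lemma ge0_rv_integralZl n (f : borel_row R n -> \bar R) (k : \bar R) :
  measurable_fun setT f -> (forall x, 0 <= f x) -> 0 <= k ->
  rv_integral (fun x => k * f x) = k * rv_integral f.
Proof.
move=> mf f0 k0; have [mu [muE _]] := row_lebesgue_measure n.
rewrite -!muE//; first by rewrite ge0_integralZl//.
- exact: measurable_funeM.
- by move=> x; rewrite mule_ge0.
Qed.

Lemma measurable_prod_coord n (g : 'I_n -> R -> \bar R) :
  (forall i, measurable_fun setT (g i)) ->
  measurable_fun setT (fun x : borel_row R n => \prod_i g i (x 0%R i)).
Proof.
move=> mg; elim: (index_enum _) => [|i r IH].
  by rewrite (_ : (fun x => _) = cst 1)//; apply/funext => x; rewrite big_nil.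
rewrite (_ : (fun x => _) = (fun x : borel_row R n => g i (x 0%R i)) \*
    (fun x => \prod_(j <- r) g j (x 0%R j))); last first.
  by apply/funext => x; rewrite big_cons.
apply: emeasurable_funM => //.
by apply: (measurableT_comp (mg i)); exact: measurable_coord.
Qed.

Lemma ge0_rv_integral_prod n (g : 'I_n -> R -> \bar R) :
  (forall i, measurable_fun setT (g i)) -> (forall i x, 0 <= g i x) ->
  rv_integral (fun x => \prod_i g i (x 0%R i)) =
  \prod_i \int[lebesgue_measure]_x g i x.
Proof.
elim: n => [|n IH] in g *; first by rewrite /= !big_ord0.
move=> mg g0 /=; rewrite big_ord_recl muleC.
have p0 : 0 <= \prod_(i < n) \int[lebesgue_measure]_x g (lift ord0 i) x.
  by apply: prode_ge0 => i _; exact: integral_ge0.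
rewrite -ge0_integralZl//; last exact: mg.
apply: eq_integral => x _.
rewrite -IH// muleC -ge0_rv_integralZl//.
- congr rv_integral; apply/funext => v; rewrite big_ord_recl.
  by rewrite (cons_row0 (x, v)); under eq_bigr do rewrite (cons_rowS (x, v)).
- exact: (measurable_prod_coord (fun i => mg (lift ord0 i))).
- by move=> v; apply: prode_ge0.
Qed.

(** The indicator of the hyperplane is a product of functions of one coordinate, one of which has
    integral 0. *)
Lemma hyperplane_null n (mu : {measure set (borel_row R n) -> \bar R}) j :
  (forall f, measurable_fun setT f -> (forall x, 0 <= f x) ->
    \int[mu]_x f x = rv_integral f) ->
  mu [set x | x 0%R j = 0%R] = 0.
Proof.
move=> muE.
pose g (i : 'I_n) : R -> \bar R :=
  if i == j then fun x => (\1_[set 0%R] x)%:E else cst 1.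
have mg i : measurable_fun setT (g i).
  rewrite /g; case: ifPn => // _; apply/measurable_EFinP.
  exact: measurable_indic.
have g0 i x : 0 <= g i x by rewrite /g; case: ifPn.
have mH : measurable ([set x | x 0%R j = 0%R] : set (borel_row R n)).
  have := @measurable_coord n j measurableT _ (measurable_set1 0%R).
  by rewrite setTI.
have <- : \int[mu]_x \prod_i g i (x 0%R i) = mu [set x | x 0%R j = 0%R].
  rewrite -[RHS]mul1e -integral_cst// [RHS]integral_mkcond.
  apply: eq_integral => x _; rewrite (bigD1 j)//= big1 ?mule1.
    rewrite /g eqxx indicE patchE.
    have [x0|/eqP x0] := eqVneq (x 0%R j) 0%R; first by rewrite !mem_set.
    by rewrite !memNset.
  by move=> i /negPf ij; rewrite /g ij.
rewrite muE//; [|exact: measurable_prod_coord|by move=> x; exact: prode_ge0].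
(* The other factors are integrals of 1 over the line; the product still vanishes because 0 * +oo =
   0 in the extended reals. *)
rewrite ge0_rv_integral_prod// (bigD1 j)//= [X in X * _](_ : _ = 0) ?mul0e//.
rewrite /g eqxx integral_indic// setIT.
exact: lebesgue_measure_set1.
Qed.

Definition rectangle n (B : 'I_n -> set R) : set 'rV[R]_n :=
  [set x | forall j, B j (x 0%R j)].

Definition rectangles n : set (set 'rV[R]_n) :=
  [set rectangle B | B in [set B | forall j, measurable (B j)]].

Lemma setI_closed_rectangles n : setI_closed (@rectangles n).
Proof.
move=> _ _ [A mA <-] [B mB <-]; exists (fun j => A j `&` B j).
  by move=> j; exact: measurableI.
by apply/seteqP; split=> [x ABx|x [Ax Bx] j]; split=> // j; case: (ABx j).
Qed.

Lemma measurable_rectangle n (B : 'I_n -> set R) :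
  (forall j, measurable (B j)) -> measurable (rectangle B : set (borel_row R n)).
Proof.
move=> mB; rewrite (_ : rectangle B =
    \bigcap_j (fun x : borel_row R n => x 0%R j) @^-1` (B j)).
  apply: fin_bigcap_measurable; first exact: finite_finset.
  move=> j _; rewrite -[X in measurable X]setTI.
  by apply: measurable_coord => //; exact: mB.
by apply/seteqP; split=> [x Bx j _|x Bx j]; exact: Bx.
Qed.

(** Rectangles form a pi-system, so two finite laws on rows need be compared on rectangles only. *)
Lemma borel_rowE n :
  (measurable : set (set (borel_row R n))) = <<s @rectangles n >>.
Proof.
apply/seteqP; split=> [A|]; last first.
  apply: smallest_sub; first exact: sigma_algebra_measurable.
  by move=> _ [B mB <-]; exact: measurable_rectangle.
have mid : measurable_fun setT
    (id : g_sigma_algebraType (@rectangles n) -> borel_row R n).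
  apply: measurable_row => j _ B mB; rewrite setTI; apply: sub_sigma_algebra.
  exists (fun i => if i == j then B else setT).
    by move=> i; case: ifPn.
  apply/seteqP; split=> x /=; first by move=> /(_ j); rewrite eqxx.
  by move=> Bx i; case: eqVneq => [->|].
by move=> /(mid measurableT); rewrite setTI.
Qed.

End borel_row.

(** * The law of the subordinated process *)

Section independence.
Context dOm (Om : measurableType dOm) (R : realType) (P : probability Om R).
Local Open Scope ereal_scope.

Lemma sub_g_sigma_measurable (G : set (set Om)) :
  G `<=` measurable -> <<s G >> `<=` measurable.
Proof. by move=> Gm; apply: smallest_sub Gm; exact: sigma_algebra_measurable. Qed.

(** The sets that satisfy the product formula with A form a Dynkin class, which contains the
    pi-system G. *)
Lemma independent_g_sigma (A : set Om) (G : set (set Om)) :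
  measurable A -> G `<=` measurable -> setI_closed G ->
  (forall E, G E -> P (A `&` E) = P A * P E) ->
  forall E, <<s G >> E -> P (A `&` E) = P A * P E.
Proof.
move=> mA Gm GI indG.
have sGm := sub_g_sigma_measurable Gm.
apply: (@dynkin_induction _ (g_sigma_algebraType G) G
  [set E : set Om | P (A `&` E) = P A * P E]) => //.
- by rewrite /= setIT probability_setT mule1.
- move=> S /sGm mS /= PAS.
  rewrite -setDE measureD//; last by rewrite ltey_eq fin_num_measure.
  rewrite [X in _ - X]PAS probability_setC// muleBr ?fin_num_measure//.
  by rewrite mule1.
- move=> F /(_ _)/sGm mF tF PAF /=.
  rewrite setI_bigcupr !measure_bigcup//.
  + rewrite -[P A in RHS]fineK ?fin_num_measure// -nneseriesZl//.
    apply: eq_eseriesr => i _; rewrite fineK ?fin_num_measure//.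
    exact: PAF.
  + by move=> i _; exact: measurableI.
  + exact: trivIset_setIl.
Qed.

(** A process starts at 0 only almost surely, so the two events differ by a null set; they are
    compared through integrals of their indicators. *)
Lemma probability_preimage_shift (X : R -> Om -> R) (u : R) (A : set R) :
  (0 <= u)%R -> measurable_process X -> {ae P, forall w, X 0%R w = 0%R} ->
  measurable A -> P (X u @^-1` A) = P (increment X 0 u @^-1` A).
Proof.
move=> u0 mX X0 mA.
have mXA : measurable (X u @^-1` A).
  by rewrite -[X in measurable X]setTI; exact: mX.
have mIA : measurable (increment X 0 u @^-1` A).
  rewrite -[X in measurable X]setTI; apply: (measurable_funB _ _) => //.
    exact: mX.
  exact: mX.
rewrite -[LHS]mul1e -[RHS]mul1e -!integral_cst// [LHS]integral_mkcond.
rewrite [RHS]integral_mkcond; apply: ae_eq_integral => //.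
- exact/measurable_restrict.
- exact/measurable_restrict.
- apply: filterS X0 => w Xw _; rewrite !patchE.
  have [wA|wA] := pselect (A (X u w)).
    by rewrite !mem_set//= /increment Xw subr0.
  by rewrite !memNset//= /increment Xw subr0.
Qed.

End independence.

(** * Joint measurability of right-continuous processes *)

Section upper_grid.
Context {R : realType}.

(* The multiple of 1 / (n + 1) just above s: right-continuity of a process makes it
   the pointwise limit of its samplings on these grids, hence jointly measurable. *)
Definition upper_grid (n : nat) (s : R) : R :=
  (Num.truncn (n.+1%:R * s)).+1%:R / n.+1%:R.

Lemma upper_grid_gt n s : 0 <= s -> s < upper_grid n s.
Proof.
move=> s0; rewrite ltr_pdivlMr// mulrC.
by have /andP[] := truncn_itv (mulr_ge0 (ler0n R n.+1) s0).
Qed.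

Lemma upper_grid_le n s : 0 <= s -> upper_grid n s <= s + n.+1%:R^-1.
Proof.
move=> s0; rewrite ler_pdivrMr// mulrDl mulVf// -natr1 lerD2r [leRHS]mulrC.
by have /andP[] := truncn_itv (mulr_ge0 (ler0n R n.+1) s0).
Qed.

Lemma cvg_upper_grid (f : R -> R) (s : R) : 0 <= s ->
  f x @[x --> s^'+] --> f s -> f (upper_grid n s) @[n --> \oo] --> f s.
Proof.
move=> s0 /cvg_at_rightP; apply; split; first by move=> n; exact: upper_grid_gt.
apply: (@squeeze_cvgr _ _ _ _ (cst s) (fun n => s + harmonic n)).
- by apply: nearW => n /=; rewrite ltW ?upper_grid_gt//=; exact: upper_grid_le.
- exact: cvg_cst.
- rewrite -[X in _ --> X]addr0; apply: cvgD; first exact: cvg_cst.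
  exact: cvg_harmonic.
Qed.

Lemma measurable_fun_right_continuous d (T : measurableType d)
    (X : R -> T -> R) :
  (forall t, 0 <= t -> measurable_fun setT (X t)) ->
  (forall w t, 0 <= t -> X x w @[x --> t^'+] --> X t w) ->
  measurable_fun setT (fun z : R * T => X `|z.1| z.2).
Proof.
move=> mX rcX.
pose h n (z : R * T) := X (upper_grid n `|z.1|) z.2.
have mh n : measurable_fun setT (h n).
  move=> _ A mA; rewrite setTI.
  (* On the strip k <= (n+1)|s| < k+1 the sampled process is frozen at the single time (k+1)/(n+1),
     so the preimage is a countable union of rectangles. *)
  rewrite (_ : _ @^-1` A = \bigcup_k
    ((fun z : R => n.+1%:R * `|z|) @^-1` `[k%:R, k.+1%:R[ `*`
     (X (k.+1%:R / n.+1%:R) @^-1` A))).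
    apply: bigcupT_measurable => k; apply: measurableX.
      rewrite -[X in measurable X]setTI.
      by apply: measurable_funM => //; exact: measurableT_comp.
    by rewrite -[X in measurable X]setTI; apply: mX => //.
  apply/seteqP; split=> -[s w] /=.
    move=> XA; exists (Num.truncn (n.+1%:R * `|s|)) => //; split=> //=.
    by rewrite in_itv/= truncn_itv// mulr_ge0.
  by move=> [k _ [/=]]; rewrite in_itv/= /h /upper_grid/= => /truncn_def ->.
apply: (measurable_fun_cvg mh) => -[s w] _ /=.
by apply: (@cvg_upper_grid (X ^~ w)) => //; exact: rcX.
Qed.

End upper_grid.

Lemma big_option (T : Type) (idx : T) (op : Monoid.com_law idx) (I : finType)
    (F : option I -> T) :
  \big[op/idx]_i F i = op (F None) (\big[op/idx]_i F (Some i)).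
Proof.
rewrite (bigD1 None)//=; congr (op _ _).
by rewrite (reindex_omap Some id)//=; [apply: eq_bigl => i; rewrite eqxx|case].
Qed.

(** * Conditioning on the Brownian time *)

Section subordinated_law.
Context dOm (Om : measurableType dOm) (R : realType) (P : probability Om R).
Local Open Scope ereal_scope.

Lemma process_sigma_algebra_measurable (X : R -> Om -> R) :
  measurable_process X -> process_sigma_algebra X `<=` measurable.
Proof.
move=> mX; apply: sub_g_sigma_measurable => _ [t /= t0 [A mA <-]].
by rewrite in_itv/= andbT in t0; exact: mX.
Qed.

Lemma process_sigma_algebra_preimage (X : R -> Om -> R) t (A : set R) :
  (0 <= t)%R -> measurable A -> process_sigma_algebra X (X t @^-1` A).
Proof.
move=> t0 mA; apply: sub_sigma_algebra; exists t; first by rewrite /= in_itv/= t0.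
by exists A; rewrite ?setTI.
Qed.

Lemma process_sigma_algebra_setI (X : R -> Om -> R) :
  setI_closed (process_sigma_algebra X).
Proof.
move=> A E mA mE.
exact: (@measurableI _ (g_sigma_algebraType (\bigcup_(t in `[0%R, +oo[)
  preimage_set_system setT (X t) measurable)) A E mA mE).
Qed.

Lemma process_sigma_algebraT (X : R -> Om -> R) :
  process_sigma_algebra X setT.
Proof.
exact: (@measurableT _ (g_sigma_algebraType (\bigcup_(t in `[0%R, +oo[)
  preimage_set_system setT (X t) measurable))).
Qed.

(** A pi-system generating the joint sigma-algebra of the Cauchy processes; closure under
    intersection is what lets independence from B extend to that whole sigma-algebra. *)
Definition cylinders (d : nat) (C : 'I_d -> R -> Om -> R) : set (set Om) :=
  [set \big[setI/setT]_j E j | E in [set E | forall j,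
    process_sigma_algebra (C j) (E j)]].

Context (d : nat) (C : 'I_d -> R -> Om -> R) (B : R -> Om -> R).
Hypothesis hC : forall j, standard_cauchy_process P (C j).
Hypothesis hB : standard_brownian_motion P B.
Hypothesis hind : independent_processes P (oapp C B).

Let mC j : measurable_process (C j). Proof. by have [] := hC j. Qed.
Let mB : measurable_process B. Proof. by have [] := hB. Qed.

Lemma cylinders_measurable : cylinders C `<=` measurable.
Proof.
move=> _ [E mE <-]; apply: bigsetI_measurable => j _.
exact: (process_sigma_algebra_measurable (@mC j) (mE j)).
Qed.

Lemma cylinders_setI : setI_closed (cylinders C).
Proof.
move=> _ _ [E mE <-] [F mF <-]; exists (fun j => E j `&` F j).
  by move=> j; exact: process_sigma_algebra_setI.
by rewrite big_split.
Qed.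

(** In [oapp C B] the index [None] stands for the Brownian motion and [Some j] for the j-th Cauchy
    process. *)
Lemma independent_option (A : set Om) (E : 'I_d -> set Om) :
  process_sigma_algebra B A -> (forall j, process_sigma_algebra (C j) (E j)) ->
  P (A `&` \big[setI/setT]_j E j) = P A * \prod_j P (E j).
Proof.
move=> mA mE; have := hind (J := [set: option 'I_d]%SET)
  (E := fun o => if o is Some j then E j else A).
have inT (o : option 'I_d) : (o \in [set: option 'I_d]%SET) = true by rewrite finset.inE.
under eq_bigl do rewrite inT; under [RHS]eq_bigl do rewrite inT.
by rewrite !big_option; apply => -[j|] _; [exact: mE|exact: mA].
Qed.

Lemma independent_cylinders (A E : set Om) :
  process_sigma_algebra B A -> <<s cylinders C >> E -> P (A `&` E) = P A * P E.
Proof.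
move=> mA; apply: independent_g_sigma.
- exact: process_sigma_algebra_measurable mA.
- exact: cylinders_measurable.
- exact: cylinders_setI.
move=> _ [F mF <-]; rewrite independent_option//; congr (_ * _).
(* The same factorisation, with the sure event in place of A, computes the probability of the
   cylinder. *)
rewrite -[in RHS](setTI (\big[_/_]_j F j)) independent_option//.
  by rewrite probability_setT mul1e.
exact: process_sigma_algebraT.
Qed.

Lemma brownian_law t (A : set R) : (0 < t)%R -> measurable A ->
  P (B t @^-1` A) = normal_prob 0 (Num.sqrt t) A.
Proof.
move=> t0 mA; have [_ B0 _ incB _] := hB.
have := incB 0%R t (lexx _) t0 A mA; rewrite subr0 => <-.
exact: probability_preimage_shift (ltW t0) mB B0 mA.
Qed.

Lemma cauchy_law j t (A : set R) : (0 < t)%R -> measurable A ->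
  P (C j t @^-1` A) = cauchy_prob t A.
Proof.
move=> t0 mA; have [_ C0 _ incC _] := hC j.
have := incC 0%R t (lexx _) t0 A mA; rewrite subr0 => <-.
exact: probability_preimage_shift (ltW t0) (@mC j) C0 mA.
Qed.

Local Notation OmC := (g_sigma_algebraType (cylinders C)).

Let mid : measurable_fun setT (id : Om -> OmC).
Proof.
move=> _ E mE; rewrite setTI.
exact: (sub_g_sigma_measurable cylinders_measurable).
Qed.

(** The outcome space carries the cylinder sigma-algebra instead of the full one: measurability for
    the latter could not be combined with independence from B. *)
Lemma measurable_cauchy_joint j :
  measurable_fun setT (fun z : R * OmC => C j `|z.1| z.2).
Proof.
apply: (@measurable_fun_right_continuous _ _ OmC (C j)).
  move=> t t0 _ A mA; rewrite setTI; apply: sub_sigma_algebra.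
  exists (fun i => if i == j then C j t @^-1` A else setT).
    move=> i; case: eqVneq => [->|_]; last exact: process_sigma_algebraT.
    exact: process_sigma_algebra_preimage.
  rewrite (bigD1 j)//= eqxx big1 ?setIT// => i /negPf ->.
  by [].
move=> w t t0; have [_ _ _ _ cC] := hC j.
by have [+ _] := cC w; exact.
Qed.

(** Freezing the Brownian time: by independence the pair made of B(t) and of the outcome, seen
    through the cylinders, has a product law on rectangles, hence on all measurable D by uniqueness
    of the product measure. *)
Lemma brownian_joint_law t (D : set (R * OmC)) : (0 < t)%R -> measurable D ->
  P ((fun w => (B t w, w)) @^-1` D) =
  \int[lebesgue_measure]_s ((normal_pdf 0 (Num.sqrt t) s)%:E * P (xsection D s)).
Proof.
move=> t0 mD.
have mBt : measurable_fun setT (B t) by exact: mB (ltW t0).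
have mpair : measurable_fun setT (fun w => (B t w, w) : R * OmC).
  by apply: measurable_fun_pair.
(* P restricted to the cylinder sigma-algebra, obtained as the law of the identity map. *)
have [m2 m2E] : exists m2 : probability OmC R, m2 = P :> (set Om -> _).
  by exists (distribution P (MeasurableFun.Pack
    (MeasurableFun.Class (isMeasurableFun.Build _ _ _ _ _ mid)))).
have [m1 m1E] : exists m1 : probability (measurableTypeR R) R,
    m1 = normal_prob 0 (Num.sqrt t) :> (_ -> _).
  by exists (normal_prob 0 (Num.sqrt t)).
have [m' m'E] : exists m' : {measure set (measurableTypeR R * OmC)%type -> \bar R},
    m' = pushforward P (fun w => (B t w, w)) :> (_ -> _).
  by unshelve eexists (pushforward P (fun w => (B t w, w) : measurableTypeR R * OmC)).
transitivity ((m1 \x m2) D).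
  have m'M (A : set (measurableTypeR R)) (E : set OmC) : measurable A -> measurable E ->
      m' (A `*` E) = m1 A * m2 E.
    move=> mA mE; rewrite m'E m2E m1E /pushforward.
    rewrite -[X in P X]/(B t @^-1` A `&` E) independent_cylinders//.
      by rewrite brownian_law.
    exact: process_sigma_algebra_preimage (ltW t0) mA.
  by rewrite (@product_measure_unique _ _ _ _ _ m1 m2 m' m'M D mD) m'E.
pose f (z : measurableTypeR R * OmC) : \bar R := (\1_D z)%:E.
pose npdf (s : R) := normal_pdf 0 (Num.sqrt t) s.
have mf : measurable_fun setT f by apply/measurable_EFinP/measurable_indic.
have f0 z : 0 <= f z by rewrite lee_fin.
transitivity (\int[m2]_w \int[m1]_s f (s, w)).
  transitivity (\int[m1 \x m2]_z f z).
    by rewrite integral_indic// setIT.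
  by rewrite fubini_tonelli1// fubini_tonelli.
transitivity (\int[m2]_w \int[lebesgue_measure]_s ((npdf s)%:E * f (s, w))).
  apply: eq_integral => w _.
  have mDw : measurable (ysection D w) by exact: measurable_ysection.
  transitivity (\int[m1]_s (\1_(ysection D w) s)%:E).
    by apply: eq_integral => s _; rewrite /f !indicE mem_ysection.
  rewrite integral_indic// setIT.
  rewrite [LHS](congr1 (@^~ (ysection D w)) m1E) /normal_prob [LHS]integral_mkcond.
  apply: eq_integral => s _; rewrite patchE /f indicE mem_ysection.
  by case: ifPn; rewrite ?mule1 ?mule0.
have mnpdf : measurable_fun setT (fun z : measurableTypeR R * OmC => (npdf z.1)%:E).
  apply/measurable_EFinP; apply: measurableT_comp (measurable_normal_pdf _ _) _.
  exact: measurable_fst.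
have npdf0 s : (0 <= npdf s)%R by exact: normal_pdf_ge0.
rewrite -(fubini_tonelli (fun z : measurableTypeR R * OmC => (npdf z.1)%:E * f z))/=.
- apply: eq_integral => s _; rewrite ge0_integralZl//.
  + congr (_ * _); rewrite -(congr1 (@^~ (xsection D s)) m2E) /=.
    transitivity (\int[m2]_w (\1_(xsection D s) w)%:E).
      by apply: eq_integral => w _; rewrite /f !indicE mem_xsection.
    by rewrite integral_indic ?setIT//; exact: measurable_xsection.
  + exact: measurableT_comp mf (measurable_pair1 _).
  + by rewrite lee_fin.
- exact: emeasurable_funM.
- by move=> z; rewrite mule_ge0// lee_fin.
Qed.

Lemma independent_cauchy (E : 'I_d -> set Om) :
  (forall j, process_sigma_algebra (C j) (E j)) ->
  P (\big[setI/setT]_j E j) = \prod_j P (E j).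
Proof.
move=> mE; have := @independent_option setT E.
rewrite setTI probability_setT mul1e; apply => //.
exact: process_sigma_algebraT.
Qed.

Lemma subordinated_cauchy_measurable t : (0 <= t)%R ->
  measurable_fun setT (fun w => \row_j C j `|B t w| w : borel_row R d).
Proof.
move=> t0; apply: measurable_row => j; under eq_fun do rewrite mxE.
have mp : measurable_fun setT (fun w => (B t w, w) : R * OmC).
  by apply: measurable_fun_pair => //; exact: mB.
exact: (measurableT_comp (measurable_cauchy_joint j) mp).
Qed.

Lemma subordinated_cauchy_rectangle t (A : 'I_d -> set R) : (0 < t)%R ->
  (forall j, measurable (A j)) ->
  P ((fun w => \row_j C j `|B t w| w) @^-1` rectangle A) =
  \int[lebesgue_measure]_s ((normal_pdf 0 (Num.sqrt t) s)%:E *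
    \prod_j P (C j `|s| @^-1` A j)).
Proof.
move=> t0 mA.
pose D : set (R * OmC) :=
  \big[setI/setT]_j (fun z => C j `|z.1| z.2) @^-1` A j.
have mD : measurable D.
  apply: bigsetI_measurable => j _; rewrite -[X in measurable X]setTI.
  exact: measurable_cauchy_joint.
have inD z : D z <-> forall j, A j (C j `|z.1| z.2).
  rewrite /D -bigcap_seq; split=> [Dz j|Dz j _]; last exact: Dz.
  by apply: Dz; rewrite /= mem_index_enum.
rewrite (_ : _ @^-1` _ = (fun w => (B t w, w)) @^-1` D); last first.
  apply/seteqP; split=> w wA.
    by apply/inD => j; have := wA j; rewrite mxE.
  by move=> j; rewrite mxE; exact: ((inD _).1 wA j).
rewrite brownian_joint_law//; apply: eq_integral => s _; congr (_ * _).
rewrite -independent_cauchy; last first.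
  by move=> j; exact: process_sigma_algebra_preimage.
congr (P _); rewrite -bigcap_seq; apply/seteqP; split=> w.
  by rewrite /xsection/= inE => /inD wA j _; exact: wA.
by move=> wA; rewrite /xsection/= inE; apply/inD => j; apply: wA; rewrite /= mem_index_enum.
Qed.

End subordinated_law.

(** * The Cauchy and Gaussian kernels *)

Section kernels.
Context {R : realType}.
Implicit Types s x t : R.

Lemma measurable_invr : measurable_fun setT (@GRing.inv R).
Proof.
rewrite -(@setvU _ [set (0 : R)]); apply/measurable_funU => //.
  exact: measurableC.
split; last exact: measurable_fun_set1.
apply: open_continuous_measurable_fun.
  by apply: closed_openC; exact: closed_eq.
by move=> x; rewrite inE /= => /eqP x0; exact: inv_continuous.
Qed.

(* The Cauchy density up to the factor pi; [qk_s], [qk_ss] and [qk_x] below are its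
   partial derivatives. *)
Definition qk s x : R := s / (s ^+ 2 + x ^+ 2).

Definition heat t s : R :=
  expR (- (s ^+ 2 / (2 * t))) / Num.sqrt (2 * pi * t).

Lemma heatE t : 0 < t -> heat t = normal_pdf 0 (Num.sqrt t).
Proof.
move=> t0; rewrite normal_pdfE ?gt_eqF ?sqrtr_gt0//; apply/funext => s.
rewrite /heat /normal_peak /normal_fun mulrC sqr_sqrtr ?ltW// subr0.
congr (_ * expR _); last by rewrite mulNr mulr_natl.
by congr (Num.sqrt _)^-1; rewrite -mulr_natl; ring.
Qed.

Lemma heat_ge0 t s : 0 <= heat t s.
Proof. by rewrite /heat divr_ge0// expR_ge0. Qed.

Lemma measurable_heat t : 0 < t -> measurable_fun setT (heat t).
Proof. by move=> /heatE ->; exact: measurable_normal_pdf. Qed.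

Lemma integrable_heat t : 0 < t ->
  lebesgue_measure.-integrable `]0, +oo[ (EFin \o heat t).
Proof.
move=> /heatE ->; apply: integrableS (integrable_normal_pdf _ _) => //.
Qed.

Lemma denom_gt0 s x : x != 0 -> 0 < s ^+ 2 + x ^+ 2.
Proof. by move=> x0; rewrite ltr_wpDl ?sqr_ge0// exprn_even_gt0. Qed.

(** From |s| |x| <= s^2 + x^2. Uniformity in s allows integration against any integrable weight; the
    price is x <> 0. *)
Lemma qk_bound s x : x != 0 -> `|qk s x| <= `|x|^-1.
Proof.
move=> x0; have D0 := denom_gt0 s x0; have nx0 : 0 < `|x| by rewrite normr_gt0.
rewrite /qk normrM normfV (gtr0_norm D0) ler_pdivrMr// mulrC ler_pdivlMr//.
have : 0 <= (`|s| - `|x|) ^+ 2 by exact: sqr_ge0.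
rewrite -(real_normK (num_real s)) -(real_normK (num_real x)).
by have := normr_ge0 s; nra.
Qed.

Lemma measurable_qk d (T : measurableType d) (f g : T -> R) :
  measurable_fun setT f -> measurable_fun setT g ->
  measurable_fun setT (fun z => qk (f z) (g z)).
Proof.
move=> mf mg; apply: measurable_funM => //; apply: (measurableT_comp measurable_invr).
by apply: measurable_funD; exact: measurable_funX.
Qed.

Lemma integrable_bounded_heat t (w : R -> R) : 0 < t ->
  measurable_fun setT w -> (exists M, forall s, `|w s| <= M) ->
  lebesgue_measure.-integrable `]0, +oo[ (fun s => (w s * heat t s)%:E).
Proof.
move=> t0 mw [M wM].
have mI : measurable (`]0, +oo[%classic : set (measurableTypeR R)).
  exact: measurable_itv.
have := integrableZl mI M (integrable_heat t0).
apply: le_integrable => //.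
  apply/measurable_EFinP/measurable_funTS/measurable_funM => //.
  exact: measurable_heat.
move=> s _ /=; rewrite lee_fin !normrM ler_wpM2r//.
by rewrite (le_trans (wM s)) ?ler_norm.
Qed.

End kernels.

(** * Expectations computed with a density *)

Section density.
Context dOm (Om : measurableType dOm) (R : realType) (P : probability Om R).
Context dT (T : measurableType dT) (mu : {sigma_finite_measure set T -> \bar R}).
Variables (X : Om -> T) (p : T -> R).
Hypotheses (mX : measurable_fun setT X) (mp : measurable_fun setT p).
Hypothesis p0 : forall x, 0 <= p x.
Hypothesis law : forall A, measurable A ->
  P (X @^-1` A) = (\int[mu]_(x in A) (p x)%:E)%E.
Local Open Scope ereal_scope.

(** Layer-cake formula: the expectation is the integral over r >= 0 of P(f(X) > r), and each tail is
    known through the law; Tonelli then restores f. *)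
Lemma ge0_integral_density (f : T -> R) :
  measurable_fun setT f -> (forall x, 0 <= f x)%R ->
  \int[P]_w (f (X w))%:E = \int[mu]_x (f x * p x)%:E.
Proof.
move=> mf f0.
have mfX : measurable_fun setT (f \o X) by exact: measurableT_comp.
pose Y : {RV P >-> R} := MeasurableFun.Pack
    (MeasurableFun.Class (isMeasurableFun.Build _ _ _ _ _ mfX)).
have : 'E_P[Y] = \int[lebesgue_measure]_(r in `[0%R, +oo[) ccdf Y r.
  by apply: ge0_expectation_ccdf => w; exact: f0.
rewrite unlock => ->.
(* The region 0 <= r < f x under the graph; its section at x has length f x. *)
pose E : set (measurableTypeR R * T) :=
  (fun z => z.1) @^-1` `[0%R, +oo[ `&` (fun z => f z.2 - z.1)%R @^-1` `]0%R, +oo[.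
have mfB : measurable_fun setT (fun z : measurableTypeR R * T => f z.2 - z.1)%R.
  apply: measurable_funB; last exact: measurable_fst.
  by apply: (measurableT_comp mf); exact: measurable_snd.
have mE : measurable E.
  apply: measurableI; rewrite -[X in measurable X]setTI.
    by apply: measurable_fst => //; exact: measurable_itv.
  by apply: mfB => //; exact: measurable_itv.
pose G (z : measurableTypeR R * T) : \bar R := (\1_E z)%:E * (p z.2)%:E.
have mG : measurable_fun setT G.
  apply: emeasurable_funM; first exact/measurable_EFinP/measurable_indic.
  by apply/measurable_EFinP; apply: (measurableT_comp mp); exact: measurable_snd.
have G0 z : 0 <= G z by rewrite mule_ge0 ?lee_fin.
transitivity (\int[lebesgue_measure]_r \int[mu]_x G (r, x)).
  rewrite integral_mkcond; apply: eq_integral => r _; rewrite patchE.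
  case: ifPn => r0; last first.
    rewrite integral0_eq// => x _; rewrite /G indicE memNset ?mul0e//.
    by move=> [/= rI _]; move: r0; rewrite notin_setE; exact.
  rewrite /ccdf /distribution /pushforward.
  have mfr : measurable [set x | (r < f x)%R].
    rewrite -[X in measurable X]setTI (_ : [set x | _] = f @^-1` `]r, +oo[).
      by apply: mf => //; exact: measurable_itv.
    by apply/seteqP; split=> x /=; rewrite in_itv/= andbT.
  rewrite (_ : _ @^-1` _ = X @^-1` [set x | (r < f x)%R]); last first.
    by apply/seteqP; split=> w /=; rewrite in_itv/= andbT.
  rewrite law// integral_mkcond; apply: eq_integral => x _.
  rewrite patchE /G indicE; case: ifPn => rfx.
    rewrite mem_set ?mul1e//; split=> /=; first by rewrite inE in r0.
    by rewrite in_itv/= andbT subr_gt0; rewrite inE in rfx.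
  rewrite memNset ?mul0e// => -[_ /=]; rewrite in_itv/= andbT subr_gt0.
  by move: rfx; rewrite notin_setE.
rewrite fubini_tonelli//; apply: eq_integral => x _.
rewrite /G/= ge0_integralZr//; last 2 first.
- by apply/measurable_EFinP; apply: measurableT_comp; [exact: measurable_indic|exact: measurable_pair2].
- by rewrite lee_fin.
rewrite EFinM; congr (_ * _).
transitivity (\int[lebesgue_measure]_r (\1_(`[0%R, f x[) r)%:E).
  apply: eq_integral => r _; rewrite !indicE; congr ((nat_of_bool _)%:R%:E).
  apply/idP/idP; rewrite !inE /E/= !in_itv/= !andbT subr_gt0.
    by move=> [-> ->].
  by move=> /andP[-> ->].
rewrite integral_indic ?setIT//.
rewrite [LHS](lebesgue_measure_itv `[0%R, f x[)/= lte_fin; case: ltP; rewrite ?oppr0 ?adde0//.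
by move=> fx0; apply/esym/eqP; rewrite eqe eq_le fx0 f0.
Qed.

(** The nonnegative case is applied to f + M, and the constant M, of finite mass on both sides, is
    subtracted. *)
Lemma integral_density (f : T -> R) (M : R) :
  measurable_fun setT f -> (forall x, `|f x| <= M)%R ->
  mu.-integrable setT (fun x => (f x * p x)%:E) /\
  \int[P]_w (f (X w))%:E = \int[mu]_x (f x * p x)%:E.
Proof.
move=> mf fM.
have M0 : (0 <= M)%R by rewrite (le_trans _ (fM (X point))).
have ip : mu.-integrable setT (EFin \o p).
  apply/integrableP; split; first exact/measurable_EFinP.
  under eq_integral do rewrite /= ger0_norm//.
  by rewrite -law// preimage_setT probability_setT ltry.
have ifp : mu.-integrable setT (fun x => (f x * p x)%:E).
  have := integrableZl measurableT M ip; apply: le_integrable => //.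
    exact/measurable_EFinP/measurable_funM.
  move=> x _ /=; rewrite lee_fin !normrM ler_wpM2r//.
  by rewrite (le_trans (fM x)) ?ler_norm.
split=> //.
have bf w : (0 <= f w + M)%R.
  by have := fM w; rewrite ler_norml => /andP[]; rewrite -subr_ge0 opprK.
have := @ge0_integral_density (fun x => f x + M)%R.
have icst : P.-integrable setT (cst M%:E) by exact: finite_measure_integrable_cst.
have iX : P.-integrable setT (fun w => (f (X w))%:E).
  apply: le_integrable icst => //.
    by apply/measurable_EFinP; exact: (measurableT_comp mf mX).
  by move=> w _ /=; rewrite lee_fin (le_trans (fM _)) ?ler_norm.
under eq_integral do rewrite EFinD.
under [in RHS]eq_integral do rewrite mulrDl EFinD.
rewrite integralD//= => /(_ _ bf).
rewrite integralD//; last first.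
  exact: (integrableZl measurableT M ip).
under [X in _ + X]eq_integral do rewrite EFinM.
rewrite integralZl// -(law measurableT) preimage_setT probability_setT mule1.
rewrite integral_cst// [X in _ + _ * X = _](probability_setT P) mule1 => H.
have {}H := H (measurable_funD mf (measurable_cst _)).
have : \int[P]_w (f (X w))%:E + M%:E - M%:E = \int[mu]_x (f x * p x)%:E + M%:E - M%:E.
  by rewrite H.
by rewrite !addeK.
Qed.

End density.

Section mixture_kernel.
Context {R : realType} {d : nat}.

(** The half-line is built into the integrand as an indicator, so that Tonelli is applied on a full
    product space. *)
Definition mixture_kernel (t s : R) (x : 'rV[R]_d) : R :=
  \1_`]0, +oo[ s * ((\prod_j qk s (x 0 j)) * heat t s).

Lemma mixture_kernel_ge0 t s x : 0 <= mixture_kernel t s x.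
Proof.
rewrite /mixture_kernel indicE; have [s0|] := boolP (s \in _); last by rewrite mul0r.
rewrite mul1r mulr_ge0 ?heat_ge0//; apply: prodr_ge0 => j _.
move: s0; rewrite inE/= in_itv/= andbT => s0.
by rewrite /qk divr_ge0 ?addr_ge0 ?sqr_ge0// ltW.
Qed.

Lemma measurable_mixture_kernel t : 0 < t ->
  measurable_fun setT (fun z : measurableTypeR R * borel_row R d =>
    mixture_kernel t z.1 z.2).
Proof.
move=> t0; apply: measurable_funM.
  apply: measurableT_comp; last exact: measurable_fst.
  by apply: measurable_indic; exact: measurable_itv.
apply: measurable_funM.
  apply: measurable_prod => j _; apply: measurable_qk; first exact: measurable_fst.
  by apply: (measurableT_comp (@measurable_coord R d j)); exact: measurable_snd.
by apply: (measurableT_comp (measurable_heat t0)); exact: measurable_fst.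
Qed.

Lemma prod_qk_bound (I : Type) (r : seq I) (Q : pred I) (x : I -> R) :
  (forall i, x i != 0) ->
  exists M, forall s, `|\prod_(i <- r | Q i) qk s (x i)| <= M.
Proof.
move=> x0; exists (\prod_(i <- r | Q i) `|x i|^-1) => s.
rewrite normr_prod; apply: ler_prod => i _.
by rewrite normr_ge0 qk_bound.
Qed.

Lemma measurable_prod_qk (I : eqType) (r : seq I) (x : I -> R) :
  measurable_fun setT (fun s : R => \prod_(i <- r) qk s (x i)).
Proof. by apply: measurable_prod => j _; apply: measurable_qk. Qed.

(** Off the hyperplanes the integral is finite and [fine] loses nothing; on them it may be infinite,
    and [Rintegral] would return 0. *)
Lemma integral_mixture_kernel t (x : 'rV[R]_d) : 0 < t -> (forall j, x 0 j != 0) ->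
  ((2 / pi ^+ d)%:E * \int[lebesgue_measure]_s (mixture_kernel t s x)%:E)%E =
  (p_CB x t)%:E.
Proof.
move=> t0 x0; rewrite /p_CB [in RHS]EFinM; congr (_ * _)%E.
rewrite /Rintegral fineK; last first.
  apply: integrable_fin_num => //.
  apply: integrable_bounded_heat => //; first exact: measurable_prod_qk.
  exact: prod_qk_bound.
rewrite [RHS]integral_mkcond; apply: eq_integral => s _.
rewrite patchE /mixture_kernel indicE; case: ifPn => _; rewrite ?mul1r ?mul0r//.
Qed.

Lemma measurable_p_CB t : 0 < t ->
  measurable_fun setT (fun x : borel_row R d => p_CB x t).
Proof.
move=> t0; apply: measurable_funM => //.
rewrite [X in measurable_fun _ X](_ : _ = fine \o fun x : borel_row R d =>
    (\int[lebesgue_measure]_s (mixture_kernel t s x)%:E)%E).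
  apply: measurableT_comp => //.
  apply: (measurable_fun_fubini_tonelli_G
    (fun z : measurableTypeR R * borel_row R d => (mixture_kernel t z.1 z.2)%:E)).
    by apply/measurable_EFinP; exact: measurable_mixture_kernel.
  by move=> z; rewrite lee_fin mixture_kernel_ge0.
apply/funext => x /=; rewrite /Rintegral; congr fine.
rewrite [LHS]integral_mkcond; apply: eq_integral => s _.
rewrite patchE /mixture_kernel indicE; case: ifPn => _; rewrite ?mul1r ?mul0r//.
Qed.

Lemma p_CB_ge0 (x : 'rV[R]_d) t : 0 <= p_CB x t.
Proof.
rewrite mulr_ge0 ?divr_ge0 ?exprn_ge0 ?pi_ge0//.
apply: Rintegral_ge0 => s /=; rewrite in_itv/= andbT => s0.
rewrite mulr_ge0 ?heat_ge0//; apply: prodr_ge0 => j _.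
by rewrite divr_ge0 ?addr_ge0 ?sqr_ge0// ltW.
Qed.

End mixture_kernel.

(** * The density of the subordinated process *)

Section density_law.
Context dOm (Om : measurableType dOm) (R : realType) (P : probability Om R).
Context (d : nat) (C : 'I_d -> R -> Om -> R) (B : R -> Om -> R).
Hypothesis hC : forall j, standard_cauchy_process P (C j).
Hypothesis hB : standard_brownian_motion P B.
Hypothesis hind : independent_processes P (oapp C B).
Variables (mu : {sigma_finite_measure set (borel_row R d) -> \bar R}).
Hypothesis muE : forall f, measurable_fun setT f -> (forall x, 0 <= f x)%E ->
  (\int[mu]_x f x = rv_integral f)%E.
Variables (t : R) (t0 : 0 < t).
Local Open Scope ereal_scope.

Local Notation npdf := (normal_pdf 0 (Num.sqrt t)).

Lemma cauchy_pdf_ge0 s x : (0 <= s)%R -> (0 <= cauchy_pdf s x :> R)%R.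
Proof. by move=> s0; rewrite divr_ge0// mulr_ge0 ?pi_ge0// addr_ge0 ?sqr_ge0. Qed.

Lemma measurable_cauchy_pdf d1 (T : measurableType d1) (f g : T -> R) :
  measurable_fun setT f -> measurable_fun setT g ->
  measurable_fun setT (fun z => cauchy_pdf (f z) (g z)).
Proof.
move=> mf mg; apply: measurable_funM => //; apply: (measurableT_comp (@measurable_invr R)).
by apply: measurable_funM => //; apply: measurable_funD; exact: measurable_funX.
Qed.

Lemma measurable_cauchy_prob (A : set R) : measurable A ->
  measurable_fun setT (fun s : R => cauchy_prob `|s| A).
Proof.
move=> mA; rewrite [X in measurable_fun _ X](_ : _ = fun s : measurableTypeR R =>
   \int[lebesgue_measure]_x ((\1_A x)%:E * (cauchy_pdf `|s| x)%:E)).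
  apply: (measurable_fun_fubini_tonelli_F
    (fun z : measurableTypeR R * measurableTypeR R =>
      (\1_A z.2)%:E * (cauchy_pdf `|z.1| z.2)%:E)).
    apply: emeasurable_funM; apply/measurable_EFinP.
      by apply: measurableT_comp; [exact: measurable_indic|exact: measurable_snd].
    apply: measurable_cauchy_pdf; last exact: measurable_snd.
    by apply: measurableT_comp => //; exact: measurable_fst.
  by move=> z; rewrite mule_ge0 ?lee_fin ?cauchy_pdf_ge0.
apply/funext => s; rewrite /cauchy_prob integral_mkcond.
apply: eq_integral => x _; rewrite patchE indicE.
by case: ifPn; rewrite ?mul1e ?mul0e.
Qed.

Lemma prod_cauchy_probE (A : 'I_d -> set R) s : (0 < s)%R ->
  (forall j, measurable (A j)) ->
  \prod_j cauchy_prob s (A j) =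
  \int[mu]_x (\1_(rectangle A) x * \prod_j cauchy_pdf s (x 0%R j))%:E.
Proof.
move=> s0 mA.
pose g (j : 'I_d) (x : R) : \bar R := (\1_(A j) x * cauchy_pdf s x)%:E.
have mg j : measurable_fun setT (g j).
  apply/measurable_EFinP/measurable_funM; first exact: measurable_indic.
  exact: measurable_cauchy_pdf.
have g0 j x : 0 <= g j x by rewrite lee_fin mulr_ge0 ?cauchy_pdf_ge0// ltW.
transitivity (\prod_j \int[lebesgue_measure]_x g j x).
  apply: eq_bigr => j _; rewrite /cauchy_prob integral_mkcond.
  apply: eq_integral => x _; rewrite patchE /g indicE.
  by case: ifPn => _; rewrite ?mul1r ?mul0r.
rewrite -ge0_rv_integral_prod// -muE; last 2 first.
- exact: measurable_prod_coord.
- by move=> x; apply: prode_ge0.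
apply: eq_integral => x _; rewrite /g prodEFin big_split/=; congr (_ * _)%:E.
rewrite indicE; have [xA|xA] := pselect (rectangle A x).
  by rewrite mem_set// big1// => j _; rewrite indicE mem_set.
rewrite memNset//; move/existsNP : (xA) => [j xAj].
by rewrite (bigD1 j)//= indicE memNset// mul0r.
Qed.

End density_law.

Section even_integral.
Context {R : realType}.
Local Open Scope ereal_scope.

Lemma ge0_even_integralT (f : R -> \bar R) : measurable_fun setT f ->
  (forall x, 0 <= f x) -> (forall x, f (- x)%R = f x) ->
  \int[lebesgue_measure]_x f x =
  2%:E * \int[lebesgue_measure]_(x in `]0%R, +oo[) f x.
Proof.
move=> mf f0 fN.
have -> : [set: R] = `]-oo, 0%R] `|` `]0%R, +oo[.
  by rewrite -(setUv `]-oo, 0%R]) setCitvl.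
rewrite ge0_integral_setU//=; last 2 first.
- exact: measurable_funTS.
- by rewrite -setCitvl; exact/disj_setPCl.
rewrite mule_natl mule2n; congr (_ + _).
rewrite integral_itv_obnd_cbnd; last exact: measurable_funTS.
rewrite ge0_integration_by_substitution0//.
by apply: eq_integral => x _; rewrite fN.
Qed.

End even_integral.

Section density_law.
Context dOm (Om : measurableType dOm) (R : realType) (P : probability Om R).
Context (d : nat) (C : 'I_d -> R -> Om -> R) (B : R -> Om -> R).
Hypothesis hC : forall j, standard_cauchy_process P (C j).
Hypothesis hB : standard_brownian_motion P B.
Hypothesis hind : independent_processes P (oapp C B).
Variables (mu : {sigma_finite_measure set (borel_row R d) -> \bar R}).
Hypothesis muE : forall f, measurable_fun setT f -> (forall x, 0 <= f x)%E ->
  (\int[mu]_x f x = rv_integral f)%E.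
Variables (t : R) (t0 : 0 < t).
Local Open Scope ereal_scope.

Local Notation npdf := (normal_pdf 0 (Num.sqrt t)).
Local Notation X := (fun w => \row_j C j `|B t w| w).

Let p_CB_cst_ge0 : (0 <= (2 / pi ^+ d : R))%R.
Proof. by rewrite divr_ge0// exprn_ge0// pi_ge0. Qed.

(** Accounts for the constant of [p_CB]: the 2 comes from folding the law of B(t) onto s > 0, the
    power of pi from the d Cauchy normalisations. *)
Lemma npdf_prod_cauchy s (x : 'rV[R]_d) : (0 < s)%R ->
  (2 * (npdf s * \prod_j cauchy_pdf s (x 0 j)) =
   2 / pi ^+ d * mixture_kernel t s x)%R.
Proof.
move=> s0; rewrite /mixture_kernel indicE mem_set; last first.
  by rewrite /= in_itv/= s0.
have -> : (\prod_j cauchy_pdf s (x 0 j) =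
    (pi ^+ d)^-1 * \prod_j qk s (x 0 j))%R.
  have -> : ((pi ^+ d)^-1 = \prod_(j < d) pi^-1 :> R)%R.
    by rewrite prodr_const card_ord exprVn.
  rewrite -big_split/=; apply: eq_bigr => j _.
  by rewrite /qk /cauchy_pdf invfM mulrCA.
by rewrite mul1r -heatE//; ring.
Qed.

(** The integrands agree off finitely many coordinate hyperplanes, all null. *)
Lemma ae_integral_mixture_kernel (A : set (borel_row R d)) : measurable A ->
  \int[mu]_(x in A) ((2 / pi ^+ d)%:E *
      \int[lebesgue_measure]_s (mixture_kernel t s x)%:E) =
  \int[mu]_(x in A) (p_CB x t)%:E.
Proof.
move=> mA; apply: ge0_ae_eq_integral => //.
- apply: measurable_funTS; apply: measurable_funeM.
  apply: (measurable_fun_fubini_tonelli_G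
    (fun z : measurableTypeR R * borel_row R d => (mixture_kernel t z.1 z.2)%:E)).
    by apply/measurable_EFinP; exact: measurable_mixture_kernel.
  by move=> z; rewrite lee_fin mixture_kernel_ge0.
- by apply/measurable_funTS/measurable_EFinP; exact: measurable_p_CB.
- move=> x _; rewrite mule_ge0// integral_ge0// => s _.
  by rewrite lee_fin mixture_kernel_ge0.
- by move=> x _; rewrite lee_fin p_CB_ge0.
have aex : {ae mu, forall x : borel_row R d, forall j, x 0%R j != 0%R}.
  apply: filter_forall => j.
  exists [set x : borel_row R d | x 0%R j = 0%R]; split.
  - have := @measurable_coord R d j measurableT _ (measurable_set1 0%R).
    by rewrite setTI.
  - exact: hyperplane_null.
  - by move=> x /= /negP; rewrite negbK => /eqP.
by apply: filterS aex => x x0 _; exact: integral_mixture_kernel.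
Qed.

Lemma law_rectangle (A : 'I_d -> set R) : (forall j, measurable (A j)) ->
  P (X @^-1` rectangle A) = \int[mu]_(x in rectangle A) (p_CB x t)%:E.
Proof.
move=> mA; rewrite (subordinated_cauchy_rectangle hC hB hind)//.
pose g (s : R) := (npdf s)%:E * \prod_j cauchy_prob `|s| (A j).
have cprob_ge0 s j : 0 <= cauchy_prob `|s|%R (A j).
  by apply: integral_ge0 => x _; rewrite lee_fin cauchy_pdf_ge0.
have g0 s : 0 <= g s.
  by rewrite mule_ge0 ?lee_fin ?normal_pdf_ge0//; exact: prode_ge0.
have mg : measurable_fun setT g.
  apply: emeasurable_funM.
    by apply/measurable_EFinP; exact: measurable_normal_pdf.
  elim: (index_enum _) => [|i r IH].
    by rewrite (_ : (fun x => _) = cst 1)//; apply/funext => x; rewrite big_nil.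
  rewrite (_ : (fun x => _) = (fun s => cauchy_prob `|s|%R (A i)) \*
      (fun s => \prod_(j <- r) cauchy_prob `|s|%R (A j))); last first.
    by apply/funext => x; rewrite big_cons.
  by apply: emeasurable_funM => //; exact: measurable_cauchy_prob.
(* At s = 0 the variable C_j(0) is almost surely 0 whereas [cauchy_pdf] vanishes identically, so
   this one point is removed before the laws are compared. *)
have nz : {in [set: R] `\ 0%R, g =1
    fun s => (npdf s)%:E * \prod_j P (C j `|s|%R @^-1` A j)}.
  move=> s; rewrite inE/= => -[_ /eqP s0]; rewrite /g; congr (_ * _).
  by apply: eq_bigr => j _; rewrite (cauchy_law hC)// normr_gt0.
have mT0 : measurable ([set: R] `\ 0%R) by exact: measurableD.
rewrite -(@integral_setD1 _ _ 0%R)//; last first.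
  by apply: eq_measurable_fun nz _; exact: measurable_funTS.
transitivity (\int[lebesgue_measure]_(s in [set: R] `\ 0%R) g s).
  by apply: eq_integral => s /nz ->.
rewrite integral_setD1//; last exact: measurable_funTS.
(* g depends on s through |s| and an even Gaussian, so each half-line contributes equally. *)
rewrite ge0_even_integralT//; last first.
  move=> s; rewrite /g normrN -!heatE// /heat sqrrN//.
pose H (z : measurableTypeR R * borel_row R d) : \bar R :=
  (\1_(rectangle A) z.2)%:E * ((2 / pi ^+ d)%:E * (mixture_kernel t z.1 z.2)%:E).
have mH : measurable_fun setT H.
  apply: emeasurable_funM.
    apply/measurable_EFinP; apply: measurableT_comp; last exact: measurable_snd.
    by apply: measurable_indic; exact: measurable_rectangle.
  by apply: measurable_funeM; apply/measurable_EFinP; exact: measurable_mixture_kernel.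
have H0 z : 0 <= H z.
  apply: mule_ge0; first by rewrite lee_fin.
  by apply: mule_ge0; rewrite lee_fin// mixture_kernel_ge0.
transitivity (\int[lebesgue_measure]_s \int[mu]_x H (s, x)).
  rewrite -ge0_integralZl//; last exact: measurable_funTS.
  rewrite integral_mkcond; apply: eq_integral => s _; rewrite patchE.
  case: ifPn => [|s0]; last first.
    rewrite integral0_eq// => x _; rewrite /H /mixture_kernel/=.
    by rewrite [\1__ s]indicE (negbTE s0) mul0r !mule0.
  rewrite inE/= in_itv/= andbT => s0.
  rewrite /g (gtr0_norm s0) (prod_cauchy_probE muE)// muleA -EFinM.
  rewrite -ge0_integralZl//; last 3 first.
  - apply/measurable_EFinP/measurable_funM.
      by apply: measurable_indic; exact: measurable_rectangle.
    apply: measurable_prod => j _; apply: measurable_cauchy_pdf => //.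
    exact: measurable_coord.
  - move=> x _; rewrite lee_fin mulr_ge0// prodr_ge0// => j _.
    by rewrite cauchy_pdf_ge0// ltW.
  - by rewrite lee_fin mulr_ge0// normal_pdf_ge0.
  apply: eq_integral => x _; rewrite /H/= -!EFinM; congr _%:E.
  by rewrite -npdf_prod_cauchy//; ring.
rewrite fubini_tonelli// -ae_integral_mixture_kernel; last exact: measurable_rectangle.
rewrite [RHS]integral_mkcond; apply: eq_integral => x _.
have mk : measurable_fun setT (fun s : measurableTypeR R => (mixture_kernel t s x)%:E).
  have := measurable_mixture_kernel (d := d) t0 => /measurable_EFinP mK.
  exact: (measurableT_comp mK (measurable_pair2 x)).
have k0 s : 0 <= (mixture_kernel t s x)%:E by rewrite lee_fin mixture_kernel_ge0.
rewrite /H/= ge0_integralZl ?ge0_integralZl//.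
- by rewrite patchE indicE; case: ifPn => _; rewrite ?mul1e ?mul0e.
- exact: measurable_funeM.
- by move=> s _; rewrite mule_ge0.
Qed.

Lemma subordinated_law (A : set (borel_row R d)) : measurable A ->
  P (X @^-1` A) = \int[mu]_(x in A) (p_CB x t)%:E.
Proof.
have mX : measurable_fun setT (X : Om -> borel_row R d).
  by have := subordinated_cauchy_measurable hC hB (ltW t0).
have mXA (E : set (borel_row R d)) : measurable E -> measurable (X @^-1` E).
  by move=> mE; rewrite -[Y in measurable Y]setTI; exact: mX.
have mp : measurable_fun setT (fun x : borel_row R d => (p_CB x t)%:E).
  by apply/measurable_EFinP; exact: measurable_p_CB.
have p0 (x : borel_row R d) : 0 <= (p_CB x t)%:E by rewrite lee_fin p_CB_ge0.
have PT : P (X @^-1` setT) = \int[mu]_x (p_CB x t)%:E.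
  have -> : [set: borel_row R d] = rectangle (fun=> setT).
    by apply/seteqP; split.
  by rewrite law_rectangle.
pose Q : set (set (borel_row R d)) :=
  [set A | P (X @^-1` A) = \int[mu]_(x in A) (p_CB x t)%:E].
rewrite borel_rowE => sA; suff : Q A by [].
apply: (@dynkin_induction _ _ _ Q (borel_rowE d) _ _ _ _ _ A sA) => //.
- exact: setI_closed_rectangles.
- by move=> _ [E mE <-]; exact: law_rectangle.
(* For a complement, the probability of S is added to both sides; being finite, it can be
   cancelled. *)
- move=> S mS /= PS; have mSC := measurableC mS.
  have : P (X @^-1` S) + P (X @^-1` ~` S) = P (X @^-1` S) +
      \int[mu]_(x in ~` S) (p_CB x t)%:E.
    rewrite [in RHS]PS -ge0_integral_setU ?setUv//; last exact/disj_setPCl.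
    rewrite -measureU; [|exact: mXA|exact: mXA|
      by rewrite -preimage_setI setICr preimage_set0].
    by rewrite -preimage_setU setUv.
  have fS : P (X @^-1` S) \is a fin_num.
    by apply: fin_num_measure; exact: mXA.
  move=> /(congr1 (fun z => z - P (X @^-1` S))).
  by rewrite ![P (X @^-1` S) + _]addeC !addeK.
- move=> F mF tF PF /=.
  rewrite /Q /= ge0_integral_bigcup//; last exact: measurable_funTS.
  rewrite preimage_bigcup measure_bigcup//.
  + rewrite (eq_eseriesl (Q := xpredT)); last by move=> i; rewrite in_setT.
    by apply: eq_eseriesr => i _; exact: PF.
  + by move=> i _; exact: mXA.
  + apply/trivIsetP => i j _ _ ij; rewrite -preimage_setI.
    by move/trivIsetP : tF => /(_ _ _ _ _ ij) ->//; rewrite preimage_set0.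
Qed.

End density_law.

(** * The density statement and the initial condition *)

Section subordinated_process.
Context dOm (Om : measurableType dOm) (R : realType) (P : probability Om R).
Context (d : nat) (C : 'I_d -> R -> Om -> R) (B : R -> Om -> R).
Hypothesis hC : forall j, standard_cauchy_process P (C j).
Hypothesis hB : standard_brownian_motion P B.
Hypothesis hind : independent_processes P (oapp C B).

Local Notation X t := (fun w => \row_j C j `|B t w| w).

Lemma subordinated_density t : 0 < t -> has_density P (X t) (p_CB ^~ t).
Proof.
move=> t0 A mA; have [mu [muE _]] := @row_lebesgue_measure R d; split.
  have mX := subordinated_cauchy_measurable hC hB (ltW t0).
  by rewrite -[Y in measurable Y]setTI; exact: mX.
rewrite (subordinated_law hC hB hind muE t0 mA) -muE; last 2 first.
- apply/measurable_EFinP/measurable_funM; last exact: measurable_p_CB.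
  exact: (@measurable_indic _ (borel_row R d)).
- by move=> x; rewrite lee_fin mulr_ge0// p_CB_ge0.
rewrite integral_mkcond; apply: eq_integral => x _; rewrite patchE indicE.
by case: ifPn => _; rewrite ?mul1r ?mul0r.
Qed.

(** Replaces an integral in x by an expectation, where the limit in t can be taken path by path. *)
Lemma rv_integral_p_CB t (phi : 'rV[R]_d -> R) (M : R) : 0 < t ->
  continuous phi -> (forall x, `|phi x| <= M) ->
  rv_integral (fun x => (phi x * p_CB x t)%:E) =
  (\int[P]_w (phi (X t w))%:E)%E.
Proof.
move=> t0 cphi phiM; have [mu [muE muiE]] := @row_lebesgue_measure R d.
have [intp ->] := @integral_density _ Om R P _ (borel_row R d) mu (X t)
  (p_CB ^~ t) (subordinated_cauchy_measurable hC hB (ltW t0))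
  (measurable_p_CB t0) (p_CB_ge0 ^~ t)
  (subordinated_law hC hB hind muE t0) phi M
  (continuous_measurable_row cphi) phiM.
by rewrite muiE.
Qed.

(** The sequence may hit 0, which a right limit does not see; there f (v n) is exactly f 0. *)
Lemma cvg_right_continuous (f : R -> R) (v : nat -> R) :
  f x @[x --> 0^'+] --> f 0 -> (forall n, 0 <= v n) ->
  v n @[n --> \oo] --> 0 -> f (v n) @[n --> \oo] --> f 0.
Proof.
move=> /cvgrPdist_lt cf v0 /cvgrPdist_lt cv; apply/cvgrPdist_lt => e e0.
have [r /= r0 rf] := cf e e0.
near=> n; have := v0 n; rewrite le_eqVlt => /predU1P[<-|vn0].
  by rewrite subrr normr0.
by apply: rf => //=; near: n; exact: cv.
Unshelve. all: end_near. Qed.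

Lemma cvg_row (u : nat -> 'rV[R]_d) (l : 'rV[R]_d) :
  (forall j, u n 0 j @[n --> \oo] --> l 0 j) -> u n @[n --> \oo] --> l.
Proof.
move=> ul; apply/cvg_mx_entourageP => E entE; near=> n => i j.
rewrite ord1 inE; move: j; near: n; apply: filter_forall => j.
have /cvg_entourageP := ul j; apply => //.
Unshelve. all: end_near. Qed.

Lemma subordinated_initial (phi : 'rV[R]_d -> R) : continuous phi ->
  (exists M : R, forall x, `|phi x| <= M) ->
  rv_integral (fun x => (phi x * p_CB x t)%:E) @[t --> 0^'+] --> (phi 0)%:E.
Proof.
move=> cphi [M phiM].
have [mBm B0 _ _ cB] := hB.
have C0 : {ae P, forall w, forall j, C j 0 w = 0}.
  by apply: filter_forall => j; have [] := hC j.
have mphiX t : 0 <= t -> measurable_fun setT (fun w => phi (X t w)).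
  move=> t0; apply: (measurableT_comp (continuous_measurable_row cphi)).
  exact: (subordinated_cauchy_measurable hC hB).
(* Dominated convergence is about sequences, and a right limit of a real function can be tested
   along sequences; hence the real-valued g. *)
pose g t := fine (\int[P]_w (phi (X t w))%:E)%E.
have gE t : 0 < t -> (g t)%:E = (\int[P]_w (phi (X t w))%:E)%E.
  move=> t0; rewrite /g fineK//; apply: integrable_fin_num => //.
  have icst : P.-integrable setT (cst M%:E) by exact: finite_measure_integrable_cst.
  apply: le_integrable icst => //.
    by apply/measurable_EFinP; exact: mphiX (ltW t0).
  by move=> w _ /=; rewrite lee_fin (le_trans (phiM _)) ?ler_norm.
have gcvg : g t @[t --> 0^'+] --> phi 0.
  apply/cvg_at_rightP => u [u0 ucvg].
  suff : (\int[P]_w (phi (X (u n) w))%:E)%E @[n --> \oo] --> (phi 0)%:E.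
    by move=> /fine_cvgP[].
  have phi0E : (\int[P]_w (phi 0)%:E)%E = (phi 0)%:E.
    by rewrite integral_cst// [Y in (_ * Y)%E](probability_setT P) mule1.
  rewrite -phi0E.
  have icst : P.-integrable setT (cst M%:E) by exact: finite_measure_integrable_cst.
  have [] := @dominated_convergence _ _ _ P setT measurableT
    (fun n w => (phi (X (u n) w))%:E) (fun=> (phi 0)%:E) (cst M%:E) _ _ _ icst _ => //.
  - by move=> n; apply/measurable_EFinP; exact: mphiX (ltW (u0 n)).
  - apply: filterS2 B0 C0 => w Bw Cw _.
    apply: cvg_EFin; first exact: nearW.
    apply: (cvg_comp _ phi); last exact: cphi.
    apply: cvg_row => j; under eq_fun do rewrite mxE.
    rewrite mxE -(Cw j); apply: (@cvg_right_continuous (C j ^~ w)) => //.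
      by have [_ _ _ _ cC] := hC j; have [+ _] := cC w; apply.
    (* Path continuity at 0 makes the random times |B(u n)| tend to |B(0)|, which is 0 for almost
       every outcome. *)
    have /continuous_within_itvcyP[_ /cvg_at_rightP Bcvg] := cB w.
    have := Bcvg u (conj u0 ucvg); rewrite Bw => /cvg_norm.
    by rewrite normr0.
  - by apply: aeW => w n _; rewrite lee_fin.
apply: (@cvg_trans _ ((g t)%:E @[t --> 0^'+])).
  apply: near_eq_cvg; near=> t.
  by rewrite gE// (@rv_integral_p_CB t phi M).
by apply: cvg_EFin; [exact: nearW|exact: gcvg].
Unshelve. all: end_near. Qed.

End subordinated_process.

(** * Derivatives of the Cauchy kernel *)

Section derivation_rules.
Context {R : realType}.
Implicit Types (f g : R -> R) (x a b : R).

Lemma is_deriveDl f g x a b : is_derive x 1 f a -> is_derive x 1 g b ->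
  is_derive x 1 (fun y => f y + g y) (a + b).
Proof. exact: is_deriveD. Qed.

Lemma is_deriveNl f x a : is_derive x 1 f a ->
  is_derive x 1 (fun y => - f y) (- a).
Proof. exact: is_deriveN. Qed.

Lemma is_deriveMl f g x a b : is_derive x 1 f a -> is_derive x 1 g b ->
  is_derive x 1 (fun y => f y * g y) (a * g x + f x * b).
Proof.
move=> df dg; apply: is_derive_eq (is_deriveM df dg) _.
by rewrite /GRing.scale/= addrC mulrC.
Qed.

Lemma is_deriveVl f x a : f x != 0 -> is_derive x 1 f a ->
  is_derive x 1 (fun y => (f y)^-1) (- a / f x ^+ 2).
Proof.
move=> f0 df; apply: is_derive_eq (is_deriveV f0 df) _.
by rewrite /GRing.scale/= mulrC mulrN mulNr.
Qed.

Lemma is_derive_compl f g x a b : is_derive (g x) 1 f a -> is_derive x 1 g b ->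
  is_derive x 1 (fun y => f (g y)) (a * b).
Proof. exact: is_derive1_comp. Qed.

Lemma is_derive_continuous f x a : is_derive x 1 f a -> {for x, continuous f}.
Proof. by move=> [df _]; exact/differentiable_continuous/derivable1_diffP. Qed.

End derivation_rules.

Section kernel_derivatives.
Context {R : realType}.
Implicit Types s x t : R.

Definition qk_s s x : R := (x ^+ 2 - s ^+ 2) / (s ^+ 2 + x ^+ 2) ^+ 2.
Definition qk_ss s x : R :=
  2 * s * (s ^+ 2 - 3 * x ^+ 2) / (s ^+ 2 + x ^+ 2) ^+ 3.
Definition qk_x s x : R := - (2 * s * x) / (s ^+ 2 + x ^+ 2) ^+ 2.

Lemma is_derive_qk_s s x : x != 0 -> is_derive s 1 (qk ^~ x) (qk_s s x).
Proof.
move=> x0; have D0 : s ^+ 2 + x ^+ 2 != 0 by rewrite gt_eqF ?denom_gt0.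
apply: is_derive_eq.
by rewrite /GRing.scale/= /qk_s; field.
Qed.

Lemma is_derive_qk_ss s x : x != 0 -> is_derive s 1 (qk_s ^~ x) (qk_ss s x).
Proof.
move=> x0; have D0 : s ^+ 2 + x ^+ 2 != 0 by rewrite gt_eqF ?denom_gt0.
have D20 : (s ^+ 2 + x ^+ 2) ^+ 2 != 0 by rewrite sqrf_eq0.
apply: is_derive_eq.
by rewrite /GRing.scale/= /qk_ss; field.
Qed.

Lemma is_derive_qk_x s x : x != 0 -> is_derive x 1 (qk s) (qk_x s x).
Proof.
move=> x0; have D0 : s ^+ 2 + x ^+ 2 != 0 by rewrite gt_eqF ?denom_gt0.
apply: is_derive_eq.
by rewrite /GRing.scale/= /qk_x; field.
Qed.

Lemma is_derive_qk_xx s x : x != 0 -> is_derive x 1 (qk_x s) (- qk_ss s x).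
Proof.
move=> x0; have D0 : s ^+ 2 + x ^+ 2 != 0 by rewrite gt_eqF ?denom_gt0.
have D20 : (s ^+ 2 + x ^+ 2) ^+ 2 != 0 by rewrite sqrf_eq0.
apply: is_derive_eq.
by rewrite /GRing.scale/= /qk_ss; field.
Qed.

Lemma qk_s_bound s x : x != 0 -> `|qk_s s x| <= (x ^+ 2)^-1.
Proof.
move=> x0; have D0 := denom_gt0 s x0.
have x20 : 0 < x ^+ 2 by rewrite exprn_even_gt0.
rewrite /qk_s normrM normfV [X in _ / X]gtr0_norm ?exprn_gt0//.
rewrite ler_pdivrMr ?exprn_gt0// [leRHS]mulrC ler_pdivlMr//.
rewrite [leRHS]expr2; apply: ler_pM; rewrite ?lerDr ?sqr_ge0//.
by rewrite ler_norml; have := sqr_ge0 s; lra.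
Qed.

Lemma qk_x_bound s x : x != 0 -> `|qk_x s x| <= (x ^+ 2)^-1.
Proof.
move=> x0; have D0 := denom_gt0 s x0.
have x20 : 0 < x ^+ 2 by rewrite exprn_even_gt0.
rewrite /qk_x normrM normfV [X in _ / X]gtr0_norm ?exprn_gt0//.
rewrite ler_pdivrMr ?exprn_gt0// [leRHS]mulrC ler_pdivlMr//.
rewrite [leRHS]expr2; apply: ler_pM; rewrite ?lerDr ?sqr_ge0//.
rewrite normrN ler_norml.
by have := sqr_ge0 (s + x); have := sqr_ge0 (s - x); nra.
Qed.

(** [qk_ss] is 2 [qk] times a rational factor bounded by 3 / x^2, whence the constant 6. *)
Lemma qk_ss_bound s x : x != 0 -> `|qk_ss s x| <= 6 * `|x|^-1 ^+ 3.
Proof.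
move=> x0; have D0 := denom_gt0 s x0.
have x20 : 0 < x ^+ 2 by rewrite exprn_even_gt0.
have -> : qk_ss s x = 2 * qk s x * ((s ^+ 2 - 3 * x ^+ 2) / (s ^+ 2 + x ^+ 2) ^+ 2).
  by rewrite /qk_ss /qk; field; rewrite gt_eqF.
rewrite normrM normrM ger0_norm//.
have h : `|(s ^+ 2 - 3 * x ^+ 2) / (s ^+ 2 + x ^+ 2) ^+ 2| <= 3 * `|x|^-1 ^+ 2.
  rewrite exprVn real_normK ?num_real// normrM normfV [`|_ ^+ 2|]gtr0_norm ?exprn_gt0//.
  rewrite ler_pdivrMr ?exprn_gt0// mulrAC ler_pdivlMr//.
  rewrite [leRHS](_ : _ = 3 * (s ^+ 2 + x ^+ 2) * (s ^+ 2 + x ^+ 2)); last by ring.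
  apply: ler_pM; rewrite ?lerDr ?sqr_ge0//.
  by rewrite ler_norml; have := sqr_ge0 s; lra.
rewrite (_ : 6 * `|x|^-1 ^+ 3 = 2 * `|x|^-1 * (3 * `|x|^-1 ^+ 2)); last by ring.
by rewrite ler_pM// ?ler_wpM2l ?qk_bound// mulr_ge0.
Qed.

End kernel_derivatives.

(** * The fundamental theorem of calculus on the half-line *)

Section signed_FTC.
Context {R : realType}.
Local Notation mu := (@lebesgue_measure R).

(** Meant for integrands that change sign, such as [riesz_kernel]: integrability is assumed, and
    truncations converge by domination by |f| instead of monotonicity. *)
Lemma integrable_continuous_FTC2y (f F : R -> R) (l : R) :
  continuous f -> (forall x : R, is_derive x 1 F (f x)) ->
  mu.-integrable `]0, +oo[ (EFin \o f) ->
  F x @[x --> +oo] --> l ->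
  \int[mu]_(x in `]0, +oo[) f x = l - F 0.
Proof.
move=> cf dF intf Fl.
have mf : measurable_fun setT f by exact: continuous_measurable_fun.
(* The endpoint is n+1 rather than n so that the interval is never degenerate. *)
pose f_ n (x : R) := (\1_`[0, n.+1%:R] x * f x)%:E.
have intE n : (\int[mu]_(x in `]0%R, +oo[) f_ n x = (F n.+1%:R - F 0)%:E)%E.
  rewrite EFinB -(@continuous_FTC2 _ f F 0 n.+1%:R)//.
  - rewrite -integral_itv_obnd_cbnd; last exact/measurable_EFinP/measurable_funTS.
    rewrite integral_mkcond [RHS]integral_mkcond; apply: eq_integral => x _.
    rewrite !patchE /f_ indicE !mem_setE !in_itv/= andbT.
    case: ltP => //= x0; rewrite ltW//=.
    by case: ifPn => _; rewrite ?mul1r ?mul0r.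
  - exact: continuous_subspaceT.
  - split.
    + by move=> x _; have [] := dF x.
    + apply: cvg_at_right_filter; exact: is_derive_continuous (dF 0).
    + apply: cvg_at_left_filter; exact: is_derive_continuous (dF _).
  - by move=> x _; rewrite derive1E; apply: derive_val.
pose D : set (measurableTypeR R) := `]0, +oo[%classic.
have mD : measurable D by exact: measurable_itv.
have mf_ n : measurable_fun D (f_ n).
  have mi : measurable_fun setT (\1_`[0, n.+1%:R] : measurableTypeR R -> R).
    by apply: measurable_indic; exact: measurable_itv.
  by apply/measurable_EFinP/measurable_funTS; exact: (measurable_funM mi mf).
have [] := @dominated_convergence _ _ _ mu D mD
  f_ (EFin \o f) (fun x => `|f x|%:E) mf_ _ _ _ _.
- exact/measurable_EFinP/measurable_funTS.
- apply: aeW => x; rewrite /D /= in_itv/= andbT => x0; apply: cvg_near_cst.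
  near=> n; rewrite /f_ indicE mem_set ?mul1r//= in_itv/= ltW//=.
  near: n; exists (Num.truncn x) => // n /= xn.
  by rewrite (le_trans (ltW (truncnS_gt x)))// ler_nat.
- exact: integrable_norm.
- apply: aeW => x n _; rewrite /f_ /= lee_fin normrM ler_piMl// indicE.
  by case: (x \in _); rewrite ?normr1 ?normr0.
move=> _ _ int_cvg.
have Fcvg : (F n.+1%:R - F 0)%:E @[n --> \oo] --> (l - F 0)%:E.
  apply: cvg_EFin; first exact: nearW.
  apply: cvgB; last exact: cvg_cst.
  move/cvg_pinftyP : Fl; apply.
  apply/cvgryPge => r; near=> n; rewrite (@le_trans _ _ n%:R) ?ler_nat//.
  by near: n; exact: nbhs_infty_ger.
have -> : l - F 0 = fine (l - F 0)%:E by [].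
rewrite /Rintegral; congr fine.
have := int_cvg; rewrite (_ : [sequence _]_n = fun n => (F n.+1%:R - F 0)%:E); last first.
  by apply/funext => n; rewrite /= intE.
by move=> /cvg_unique; apply.
Unshelve. all: end_near. Qed.

End signed_FTC.

(** * The Riesz derivative of a mixture of Cauchy kernels *)

Section second_difference.
Context {R : realType}.
Implicit Types s x y : R.

(* The closed form of [riesz_integrand (qk s) x y], without its removable
   singularity at y = 0. *)
Definition riesz_kernel s x y : R :=
  2 * s * (3 * x ^+ 2 - s ^+ 2 - y ^+ 2) /
  ((s ^+ 2 + x ^+ 2) * ((s ^+ 2 + (y - x) ^+ 2) * (s ^+ 2 + (y + x) ^+ 2))).

Let sD_gt0 s z : 0 < s -> 0 < s ^+ 2 + z ^+ 2.
Proof. by move=> s0; rewrite ltr_wpDr ?sqr_ge0// exprn_gt0. Qed.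

Lemma riesz_integrand_qk s x y : 0 < s -> y != 0 ->
  riesz_integrand (qk s) x y = riesz_kernel s x y.
Proof.
move=> s0 y0; rewrite /riesz_integrand /riesz_kernel /qk.
have h1 := lt0r_neq0 (sD_gt0 x s0).
have h4 : s ^+ 2 + (y - x) ^+ 2 != 0 by exact: lt0r_neq0 (sD_gt0 _ s0).
have h5 : s ^+ 2 + (y + x) ^+ 2 != 0 by exact: lt0r_neq0 (sD_gt0 _ s0).
by field; rewrite h5 h4 h1 y0.
Qed.

Lemma riesz_kernel_abs s x y : riesz_kernel s `|x| y = riesz_kernel s x y.
Proof.
rewrite /riesz_kernel real_normK ?num_real//; congr (_ / (_ * _)).
by case: (ger0P x) => // x0; rewrite opprK mulrC.
Qed.

(* The right-hand side is integrable in y uniformly in s, as Fubini requires. *)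
Lemma riesz_kernel_bound s x y : 0 < s -> 0 < y -> x != 0 ->
  `|riesz_kernel s x y| <=
  6 * (x ^+ 2)^-1 * (s / (s ^+ 2 + (y - `|x|) ^+ 2)).
Proof.
move=> s0 y0; rewrite -normr_gt0 => x0; rewrite -riesz_kernel_abs.
rewrite -(real_normK (num_real x)); move: `|x| x0 => {}x x0.
rewrite /riesz_kernel.
have h1 := sD_gt0 x s0; have h2 := sD_gt0 (y - x) s0; have h3 := sD_gt0 (y + x) s0.
rewrite normrM normfV [`|_ * (_ * _)|]gtr0_norm ?mulr_gt0//.
rewrite ler_pdivrMr ?mulr_gt0// normrM gtr0_norm ?mulr_gt0//.
have -> : 6 * (x ^+ 2)^-1 * (s / (s ^+ 2 + (y - x) ^+ 2)) *
    ((s ^+ 2 + x ^+ 2) * ((s ^+ 2 + (y - x) ^+ 2) * (s ^+ 2 + (y + x) ^+ 2))) =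
    2 * s * (((s ^+ 2 + x ^+ 2) / x ^+ 2) * (3 * (s ^+ 2 + (y + x) ^+ 2))).
  by field; rewrite !gt_eqF.
(* Two separate bounds remain: 1 <= (s^2 + x^2) / x^2, and |3x^2 - s^2 - y^2| <= 3 (s^2 + (y +
   x)^2), which uses x y > 0. *)
rewrite ler_pM2l ?mulr_gt0// -[leLHS]mul1r; apply: ler_pM => //.
  by rewrite ler_pdivlMr ?exprn_gt0// mul1r lerDr sqr_ge0.
by rewrite ler_norml; have := mulr_gt0 x0 y0; have := sqr_ge0 s; nra.
Qed.

Lemma is_derive_atan_div s (c y : R) : 0 < s ->
  is_derive y 1 (fun y => atan ((y + c) / s)) (s / (s ^+ 2 + (y + c) ^+ 2)).
Proof.
move=> s0; have sn0 := lt0r_neq0 s0.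
have d1 : is_derive y 1 (fun y => (y + c) / s) s^-1.
  by apply: is_derive_eq; rewrite /GRing.scale/=; ring.
apply: is_derive_eq (is_derive_compl (is_derive1_atan _) d1) _.
have := lt0r_neq0 (sD_gt0 (y + c) s0) => D0.
have h : 1 + ((y + c) / s) ^+ 2 = (s ^+ 2 + (y + c) ^+ 2) / s ^+ 2 by field.
by rewrite h; field; rewrite D0 sn0.
Qed.

Lemma cvgy_atan_div s (c : R) : 0 < s ->
  atan ((y + c) / s) @[y --> +oo] --> pi / 2.
Proof.
move=> s0; apply: (cvg_comp _ atan); last exact: cvgy_atan.
by apply: gt0_cvgMly; [rewrite invr_gt0|exact: cvg_addrr].
Qed.

(** The mass of this kernel over the whole line is pi whatever the scale and the center; here it is
    read off the bounds of [atan]. *)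
Lemma cauchy_integral_bound s (c : R) : 0 < s ->
  (\int[lebesgue_measure]_(y in `]0%R, +oo[)
     (s / (s ^+ 2 + (y - c) ^+ 2))%:E <= pi%:E)%E.
Proof.
move=> s0.
have D0 z := lt0r_neq0 (sD_gt0 z s0).
have cf : continuous (fun y : R => s / (s ^+ 2 + (y - c) ^+ 2)).
  move=> y; have dy : is_derive y 1 (fun y : R => s / (s ^+ 2 + (y - c) ^+ 2))
     (- s * (2 * (y - c)) / (s ^+ 2 + (y - c) ^+ 2) ^+ 2).
    have D0' := D0 (y - c).
    by apply: is_derive_eq; rewrite /GRing.scale/=; field.
  exact: is_derive_continuous dy.
have d1 (y : R) := @is_derive_atan_div s (- c) y s0.
rewrite integral_itv_obnd_cbnd; last first.
  by apply/measurable_EFinP/measurable_funTS; exact: continuous_measurable_fun.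
rewrite (@ge0_continuous_FTC2y _ _ (fun y => atan ((y - c) / s)) 0 (pi / 2)).
- rewrite -EFinB lee_fin sub0r.
  by have := @atan_gtNpi2 R (- c / s); lra.
- by move=> y _; rewrite divr_ge0 ?addr_ge0 ?sqr_ge0 ?ltW.
- exact: continuous_subspaceT.
- exact: cvgy_atan_div.
- by move=> y _; have [] := d1 y.
- by apply: cvg_at_right_filter; exact: is_derive_continuous (d1 0).
- by move=> y _; rewrite derive1E; have := d1 y => d2; exact: derive_val.
Qed.

End second_difference.

(** * The integral of the Riesz kernel *)

Section riesz_kernel_integral.
Context {R : realType}.
Implicit Types s x y : R.
Local Notation mu := (@lebesgue_measure R).

Let sD_gt0 s z : 0 < s -> 0 < s ^+ 2 + z ^+ 2.
Proof. by move=> s0; rewrite ltr_wpDr ?sqr_ge0// exprn_gt0. Qed.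

Lemma is_derive_ln_sqr s (c y : R) : 0 < s ->
  is_derive y 1 (fun y => ln (s ^+ 2 + (y + c) ^+ 2))
    (2 * (y + c) / (s ^+ 2 + (y + c) ^+ 2)).
Proof.
move=> s0; have D0 := sD_gt0 (y + c) s0.
have d1 : is_derive y 1 (fun y => s ^+ 2 + (y + c) ^+ 2) (2 * (y + c)).
  by apply: is_derive_eq; rewrite /GRing.scale/=; ring.
have H := @is_derive_compl _ _ (fun y => s ^+ 2 + (y + c) ^+ 2) _ _ _ (is_derive1_ln D0) d1.
move/is_derive_eq: H; apply.
by rewrite mulrC.
Qed.

(* Obtained by partial fractions in y; it vanishes at 0 and tends to
   pi * qk_s s x at infinity. *)
Definition riesz_antideriv s x y : R :=
  ((x ^+ 2 - s ^+ 2) * (atan ((y - x) / s) + atan ((y + x) / s)) -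
   x * s * (ln (s ^+ 2 + (y - x) ^+ 2) - ln (s ^+ 2 + (y + x) ^+ 2))) /
  (s ^+ 2 + x ^+ 2) ^+ 2.

Lemma is_derive_riesz_antideriv s x y : 0 < s ->
  is_derive y 1 (riesz_antideriv s x) (riesz_kernel s x y).
Proof.
move=> s0.
have a1 := is_derive_atan_div (- x) y s0; have a2 := is_derive_atan_div x y s0.
have l1 := is_derive_ln_sqr (- x) y s0; have l2 := is_derive_ln_sqr x y s0.
have h1 := lt0r_neq0 (sD_gt0 x s0).
have h2 := lt0r_neq0 (sD_gt0 (y - x) s0).
have h3 := lt0r_neq0 (sD_gt0 (y + x) s0).
have dc (c : R) : is_derive y 1 (fun=> c) 0 := is_derive_cst c y 1.
have H := is_deriveMl (is_deriveDl
  (is_deriveMl (dc (x ^+ 2 - s ^+ 2)) (is_deriveDl a1 a2))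
  (is_deriveNl (is_deriveMl (dc (x * s)) (is_deriveDl l1 (is_deriveNl l2)))))
  (dc ((s ^+ 2 + x ^+ 2) ^+ 2)^-1).
have {}H : is_derive y 1 (riesz_antideriv s x) _ := H.
move/is_derive_eq: H; apply.
by rewrite /riesz_kernel; field; rewrite h1 h2 h3.
Qed.

Lemma cvgy_ln_ratio s x : 0 < s ->
  ln (s ^+ 2 + (y - x) ^+ 2) - ln (s ^+ 2 + (y + x) ^+ 2) @[y --> +oo] --> 0.
Proof.
move=> s0; rewrite -[X in _ --> X]ln1.
under eq_fun do rewrite -ln_div ?posrE ?sD_gt0//.
apply: (cvg_comp _ (@ln R)); last exact: continuous_ln.
apply/cvgrPdist_le => e e0; near=> y.
have h3 := sD_gt0 (y + x) s0.
have -> : 1 - (s ^+ 2 + (y - x) ^+ 2) / (s ^+ 2 + (y + x) ^+ 2) =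
    4 * x * y / (s ^+ 2 + (y + x) ^+ 2) by field; rewrite gt_eqF.
(* From y >= 2|x| follows y + x >= y/2, so the denominator is at least y^2/4; then 4|x|y is at most
   e times it as soon as 16|x| <= e y. *)
have y1 : 1 <= y by near: y; apply: nbhs_pinfty_ge; rewrite num_real.
have yx : 2 * `|x| <= y by near: y; apply: nbhs_pinfty_ge; rewrite num_real.
have ye : 16 * `|x| / e <= y by near: y; apply: nbhs_pinfty_ge; rewrite num_real.
rewrite normrM normfV (gtr0_norm h3) ler_pdivrMr// !normrM.
rewrite [`|4|]ger0_norm// [`|y|]ger0_norm; last by lra.
have xy : y ^+ 2 <= 4 * (s ^+ 2 + (y + x) ^+ 2).
  have : y / 2 <= y + x by have := ler_norm (- x); rewrite normrN; lra.
  by have := sqr_ge0 s; nra.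
have : 16 * `|x| <= y * e by rewrite -ler_pdivrMr.
by nra.
Unshelve. all: end_near. Qed.

Lemma riesz_antideriv_y s x : 0 < s ->
  riesz_antideriv s x y @[y --> +oo] --> pi * qk_s s x.
Proof.
move=> s0; rewrite (_ : pi * qk_s s x = ((x ^+ 2 - s ^+ 2) * (pi / 2 + pi / 2) -
   x * s * 0) / (s ^+ 2 + x ^+ 2) ^+ 2); last first.
  by rewrite /qk_s mulr0 subr0 -splitr; ring.
apply: cvgMl; apply: cvgB; apply: cvgMr; last exact: cvgy_ln_ratio.
by apply: cvgD; [exact: (@cvgy_atan_div _ _ (- x))|exact: cvgy_atan_div].
Qed.

Lemma riesz_antideriv0 s x : riesz_antideriv s x 0 = 0.
Proof.
rewrite /riesz_antideriv sub0r add0r mulNr atanN addNr sqrrN subrr.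
by rewrite !mulr0 subr0 mul0r.
Qed.

Lemma continuous_riesz_kernel s x : 0 < s -> continuous (riesz_kernel s x).
Proof.
move=> s0 y.
have h1 := lt0r_neq0 (sD_gt0 x s0).
have h2 := lt0r_neq0 (sD_gt0 (y - x) s0).
have h3 := lt0r_neq0 (sD_gt0 (y + x) s0).
have h4 : (s ^+ 2 + x ^+ 2) * ((s ^+ 2 + (y - x) ^+ 2) * (s ^+ 2 + (y + x) ^+ 2)) != 0.
  by rewrite !mulf_neq0.
apply: (@is_derive_continuous _ _ _ ('D_1 (riesz_kernel s x) y)).
apply: DeriveDef => //; apply: ex_derive.
Qed.

(** Free of s: integrating the absolute value in y leaves a constant multiple of the weight, which
    is integrable. *)
Lemma riesz_kernel_integral_bound s x : 0 < s -> x != 0 ->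
  (\int[mu]_(y in `]0%R, +oo[) `|riesz_kernel s x y|%:E <=
   (6 * (x ^+ 2)^-1 * pi)%:E)%E.
Proof.
move=> s0 x0; have mr : measurable_fun setT (riesz_kernel s x).
  by apply: continuous_measurable_fun; exact: continuous_riesz_kernel.
have mK : measurable_fun setT (fun y : R => s / (s ^+ 2 + (y - `|x|) ^+ 2)).
  apply: measurable_funM => //; apply: (measurableT_comp (@measurable_invr R)).
  by apply: measurable_funD => //; apply: measurable_funX; exact: measurable_funB.
have c0 : 0 <= 6 * (x ^+ 2)^-1 :> R by rewrite mulr_ge0// invr_ge0 sqr_ge0.
apply: (@le_trans _ _ (\int[mu]_(y in `]0%R, +oo[)
    ((6 * (x ^+ 2)^-1)%:E * (s / (s ^+ 2 + (y - `|x|) ^+ 2))%:E))%E).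
  apply: ge0_le_integral => //.
  - by apply/measurable_EFinP/measurable_funTS; exact: measurableT_comp.
  - by apply: measurable_funeM; apply/measurable_EFinP/measurable_funTS.
  - move=> y; rewrite /= in_itv/= andbT => y0; rewrite -EFinM lee_fin.
    exact: riesz_kernel_bound.
rewrite ge0_integralZl//=.
- by rewrite [leRHS]EFinM lee_wpmul2l ?lee_fin//; exact: cauchy_integral_bound.
- exact/measurable_EFinP/measurable_funTS.
- by move=> y _; rewrite lee_fin divr_ge0 ?addr_ge0 ?sqr_ge0 ?ltW.
Qed.

Lemma integrable_riesz_kernel s x : 0 < s -> x != 0 ->
  mu.-integrable `]0, +oo[ (EFin \o riesz_kernel s x).
Proof.
move=> s0 x0; apply/integrableP; split.
  apply/measurable_EFinP/measurable_funTS.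
  by apply: continuous_measurable_fun; exact: continuous_riesz_kernel.
by apply: le_lt_trans (riesz_kernel_integral_bound s0 x0) _; rewrite ltry.
Qed.

(** Only the value of the antiderivative at infinity contributes; its pi will cancel the
    normalisation of [riesz_derivative]. *)
Lemma riesz_kernel_integral s x : 0 < s -> x != 0 ->
  \int[mu]_(y in `]0, +oo[) riesz_kernel s x y = pi * qk_s s x.
Proof.
move=> s0 x0.
rewrite (integrable_continuous_FTC2y (continuous_riesz_kernel s0)
  (fun y => is_derive_riesz_antideriv x y s0) (integrable_riesz_kernel s0 x0)
  (@riesz_antideriv_y s x s0)).
by rewrite riesz_antideriv0 subr0.
Qed.

End riesz_kernel_integral.

(** * Fubini for the Riesz integral of a mixture *)

Section riesz_mixture.
Context {R : realType}.
Local Notation mu := (@lebesgue_measure R).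
Local Notation Rpos := (`]0%R, +oo[%classic : set (measurableTypeR R)).
(** F is prescribed off 0 only, since the mixture may diverge at 0; its measurability is therefore a
    separate hypothesis. *)
Variables (v F : R -> R) (x : R).
Hypotheses (mv : measurable_fun setT v) (iv : mu.-integrable Rpos (EFin \o v)).
Hypotheses (mF : measurable_fun setT F) (x0 : x != 0).
Hypothesis FE : forall z, z != 0 -> F z = \int[mu]_(s in `]0, +oo[) (v s * qk s z).

Let mRpos : measurable Rpos. Proof. exact: measurable_itv. Qed.

Lemma integrable_bounded_mul (w : R -> R) (M : R) : measurable_fun setT w ->
  (forall s, `|w s| <= M) -> mu.-integrable Rpos (fun s => (v s * w s)%:E).
Proof.
move=> mw wM; have := integrableZl mRpos M iv; apply: le_integrable => //.
  exact/measurable_EFinP/measurable_funTS/measurable_funM.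
move=> s _ /=; rewrite lee_fin !normrM mulrC ler_wpM2r//.
by rewrite (le_trans (wM s)) ?ler_norm.
Qed.

Lemma integrable_mul_qk z : z != 0 ->
  mu.-integrable Rpos (fun s => (v s * qk s z)%:E).
Proof.
move=> z0; apply: (@integrable_bounded_mul _ `|z|^-1).
  exact: measurable_qk.
by move=> s; exact: qk_bound.
Qed.

(** The double integrand, extended by 0 outside the open quadrant. *)
Let G (z : measurableTypeR R * measurableTypeR R) : \bar R :=
  (\1_Rpos z.1 * \1_Rpos z.2 * (v z.1 * riesz_kernel z.1 x z.2))%:E.

Let mG : measurable_fun setT G.
Proof.
have m1 : measurable_fun setT (fun z : measurableTypeR R * measurableTypeR R => z.1 : R).
  exact: measurable_fst.
have m2 : measurable_fun setT (fun z : measurableTypeR R * measurableTypeR R => z.2 : R).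
  exact: measurable_snd.
apply/measurable_EFinP/measurable_funM.
  apply: measurable_funM.
    by apply: measurableT_comp; [exact: measurable_indic|exact: measurable_fst].
  by apply: measurableT_comp; [exact: measurable_indic|exact: measurable_snd].
apply: measurable_funM; first exact: (measurableT_comp mv m1).
apply: measurable_funM.
  apply: measurable_funM; first exact: measurable_funM.
  apply: measurable_funB; last exact: measurable_funX.
  by apply: measurable_funB => //; exact: measurable_funX.
apply: (measurableT_comp (@measurable_invr R)).
apply: measurable_funM.
  by apply: measurable_funD => //; exact: measurable_funX.
apply: measurable_funM; apply: measurable_funD; apply: measurable_funX => //.
  exact: measurable_funB.
exact: measurable_funD.
Qed.

Let GpE s : Rpos s ->
  (fun y => G (s, y)) = (fun y => (v s)%:E * (riesz_kernel s x y)%:E)%E \_ Rpos.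
Proof.
move=> s0; apply/funext => y; rewrite patchE /G/= !indicE (mem_set s0) mul1r.
by case: ifPn => _; rewrite ?mul1r ?mul0r// EFinM.
Qed.

Let G0 s : ~ Rpos s -> (fun y => G (s, y)) = cst 0%E.
Proof.
by move=> s0; apply/funext => y; rewrite /G/= !indicE (memNset s0) !mul0r.
Qed.

Let Rpos_gt0 s : Rpos s -> 0 < s.
Proof. by rewrite /= in_itv/= andbT. Qed.

(** By Tonelli it is enough to integrate |G| in y first, where the bound c |v s| with c independent
    of s is available. *)
Let iG : (mu \x mu)%E.-integrable setT G.
Proof.
have [_ ifin] := @integrable12ltyP _ _ _ _ _ mu mu G mG; apply: ifin.
pose c : R := 6 * (x ^+ 2)^-1 * pi.
apply: (@le_lt_trans _ _ (\int[mu]_(s in Rpos) (`|v s| * c)%:E)%E); last first.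
  have ic : mu.-integrable Rpos (fun s => (v s * c)%:E).
    by apply: (@integrable_bounded_mul (cst c) `|c|).
  have /integrableP[_] := ic; apply: le_lt_trans.
  apply: ge0_le_integral => //.
  - by move=> s _; rewrite lee_fin mulr_ge0// !mulr_ge0 ?pi_ge0// invr_ge0 sqr_ge0.
  - apply/measurable_EFinP/measurable_funTS/measurable_funM => //.
    exact: measurableT_comp.
  - by apply: measurableT_comp => //; exact: (measurable_int _ ic).
  - by move=> s _ /=; rewrite lee_fin normrM ler_wpM2l// ler_norm.
rewrite [leRHS]integral_mkcond; apply: ge0_le_integral => //.
- by move=> s _; exact: integral_ge0.
- apply: (measurable_fun_fubini_tonelli_F (abse \o G)).
    exact: measurableT_comp.
  by move=> z; exact: abse_ge0.
- apply/(measurable_restrictT _ mRpos).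
  apply/measurable_EFinP/measurable_funTS/measurable_funM => //.
  exact: measurableT_comp.
- move=> s _; rewrite patchE; case: ifPn => [|]; rewrite ?inE ?notin_setE => s0; last first.
    rewrite integral0_eq// => y _.
    by have -> : G (s, y) = 0%E := congr1 (@^~ y) (G0 s0); rewrite abse0.
  have s_gt0 := Rpos_gt0 s0.
  have mk : measurable_fun Rpos (fun y => `|riesz_kernel s x y|%:E).
    apply/measurable_EFinP; apply: measurableT_comp => //.
    apply/measurable_EFinP.
    exact: (measurable_int _ (integrable_riesz_kernel s_gt0 x0)).
  apply: (@le_trans _ _ (\int[mu]_(y in Rpos) (`|v s|%:E * `|riesz_kernel s x y|%:E)))%E.
    rewrite [leRHS]integral_mkcond; apply: ge0_le_integral => //.
    + by apply: measurableT_comp => //; exact: (measurableT_comp mG (measurable_pair1 s)).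
    + by apply/(measurable_restrictT _ mRpos); apply: measurable_funeM; exact: mk.
    + move=> y _; have -> := congr1 (@^~ y) (GpE s0); rewrite !patchE.
      by case: ifPn => _; rewrite ?abse0// abseM.
  rewrite ge0_integralZl//=.
  by rewrite EFinM lee_wpmul2l//; exact: riesz_kernel_integral_bound.
Qed.

(** At y = |x| one of x - y and x + y is 0, where F is unknown; for every other y > 0 the second
    difference passes under the integral by linearity. *)
Let integrandE y : Rpos y -> y != `|x| ->
  (riesz_integrand F x y)%:E = (\int[mu]_s G (s, y))%E.
Proof.
move=> y0 yx; have y_gt0 := Rpos_gt0 y0.
have xmy : x - y != 0.
  by apply: contra_neq yx => /subr0_eq ->; rewrite gtr0_norm.
have xpy : x + y != 0.
  apply: contra_neq yx => /eqP; rewrite addr_eq0 => /eqP ->.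
  by rewrite normrN gtr0_norm.
have i1 := integrable_mul_qk xmy; have i2 := integrable_mul_qk xpy.
have i3 := integrable_mul_qk x0.
transitivity (\int[mu]_(s in Rpos) (((y ^+ 2)^-1)%:E *
    ((v s * qk s (x - y))%:E - 2%:E * (v s * qk s x)%:E + (v s * qk s (x + y))%:E)))%E.
  rewrite integralZl//; last first.
    by apply: integrableD => //; apply: integrableB => //; exact: integrableZl.
  rewrite integralD//; last by apply: integrableB => //; exact: integrableZl.
  rewrite integralB//; last exact: integrableZl.
  rewrite integralZl// /riesz_integrand !FE// /Rintegral mulrC.
  by rewrite !EFinM !EFinD EFinN EFinM !fineK//; exact: integrable_fin_num.
rewrite integral_mkcond; apply: eq_integral => s _; rewrite patchE.
case: ifPn => [|]; rewrite ?inE ?notin_setE => s0; last first.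
  by have -> : G (s, y) = 0%E := congr1 (@^~ y) (G0 s0).
have -> := congr1 (@^~ y) (GpE s0); rewrite patchE mem_set//.
rewrite -riesz_integrand_qk ?Rpos_gt0//; last by rewrite gt_eqF.
rewrite -!EFinM; congr _%:E.
by rewrite /riesz_integrand; ring.
Qed.

Let ae_integrandE : ae_eq mu Rpos (EFin \o riesz_integrand F x)
  (fun y => \int[mu]_s G (s, y))%E.
Proof.
exists [set `|x|]; split => //; first exact: lebesgue_measure_set1.
move=> y /= /not_implyP[y0 yE]; apply: contrapT => yx; apply: yE.
by apply: integrandE => //; apply/eqP.
Qed.

Let mintegrand : measurable_fun Rpos (EFin \o riesz_integrand F x).
Proof.
apply/measurable_EFinP/measurable_funTS.
apply: measurable_funM.
  apply: measurable_funD; last by apply: (measurableT_comp mF); exact: measurable_funD.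
  apply: measurable_funB => //.
  by apply: (measurableT_comp mF); exact: measurable_funB.
by apply: (measurableT_comp (@measurable_invr R)); exact: measurable_funX.
Qed.

Let iFG : mu.-integrable setT (fun y => \int[mu]_s G (s, y))%E.
Proof.
apply/integrableP; split; first exact: (measurable_fubini_G iG).
have [/(_ iG) + _] := @integrable21ltyP _ _ _ _ _ mu mu G mG.
apply: le_lt_trans; apply: ge0_le_integral => //.
- by apply: measurableT_comp => //; exact: (measurable_fubini_G iG).
- apply: (measurable_fun_fubini_tonelli_G (abse \o G)).
    exact: measurableT_comp.
  by move=> z; exact: abse_ge0.
- move=> y _; apply: le_abse_integral => //.
  exact: (measurableT_comp mG (measurable_pair2 y)).
Qed.

Lemma riesz_derivable_mixture : riesz_derivable F x.
Proof.
have iP : mu.-integrable Rpos (fun y => \int[mu]_s G (s, y))%E.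
  exact: integrableS iFG.
apply/integrableP; split; first exact: mintegrand.
have /integrableP[mP] := iP; apply: le_lt_trans.
rewrite le_eqVlt; apply/orP; left; apply/eqP; apply: ae_eq_integral => //.
- exact: measurableT_comp mintegrand.
- exact: measurableT_comp mP.
- by apply: filterS ae_integrandE => y H ry; rewrite -(H ry).
Qed.

(** After the exchange of integrals the inner one is v s times pi [qk_s], and the factor -1/pi
    leaves the minus sign. *)
Lemma riesz_derivative_mixture :
  riesz_derivative F x = \int[mu]_(s in `]0, +oo[) (v s * - qk_s s x).
Proof.
have ipi : mu.-integrable Rpos (fun s => (v s * qk_s s x)%:E).
  apply: (@integrable_bounded_mul (qk_s ^~ x) (x ^+ 2)^-1).
    apply: continuous_measurable_fun => s.
    exact: is_derive_continuous (is_derive_qk_ss s x0).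
  by move=> s; exact: qk_s_bound.
have E : (\int[mu]_(y in Rpos) (riesz_integrand F x y)%:E =
    \int[mu]_(s in Rpos) (pi%:E * (v s * qk_s s x)%:E))%E.
  transitivity (\int[mu]_(y in Rpos) \int[mu]_s G (s, y))%E.
    apply: ae_eq_integral => //.
    by apply: measurable_funTS; exact: (measurable_int _ iFG).
  transitivity (\int[mu]_y \int[mu]_s G (s, y))%E.
    rewrite integral_mkcond; apply: eq_integral => y _; rewrite patchE.
    case: ifPn => //; rewrite notin_setE => y0.
    rewrite integral0_eq// => s _.
    by rewrite /G/= [\1__ y]indicE (memNset y0) mulr0 mul0r.
  rewrite -(Fubini iG) [RHS]integral_mkcond; apply: eq_integral => s _.
  rewrite patchE; case: ifPn => [|]; rewrite ?inE ?notin_setE => s0; last first.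
    by rewrite (G0 s0) integral0.
  rewrite (GpE s0) -integral_mkcond.
  have ik := integrable_riesz_kernel (Rpos_gt0 s0) x0.
  rewrite integralZl//.
  have <- : (\int[mu]_(y in Rpos) riesz_kernel s x y)%:E =
      (\int[mu]_(y in Rpos) (riesz_kernel s x y)%:E)%E.
    by rewrite /Rintegral fineK//; exact: integrable_fin_num.
  by rewrite riesz_kernel_integral ?Rpos_gt0// -!EFinM; congr _%:E; ring.
rewrite /riesz_derivative /Rintegral E integralZl//.
have -> : (\int[mu]_(s in Rpos) (v s * - qk_s s x)%:E =
    (-1)%:E * \int[mu]_(s in Rpos) (v s * qk_s s x)%:E)%E.
  rewrite -integralZl//; apply: eq_integral => s _.
  by rewrite -EFinM; congr _%:E; ring.
rewrite !fineM//; [|exact: integrable_fin_num|exact: integrable_fin_num].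
by rewrite /= mulrA mulNr mulVf// gt_eqF// pi_gt0.
Qed.

End riesz_mixture.

(** * Differentiation of mixtures under the integral *)

Section derivative_under_integral.
Context {R : realType}.
Local Notation mu := (@lebesgue_measure R).
Local Notation Rpos := (`]0%R, +oo[%classic : set (measurableTypeR R)).

Lemma is_derive_Rintegral (f f' : R -> R -> R) (G : R -> R) (a u w : R) :
  u < a < w ->
  (forall z, u < z < w -> mu.-integrable Rpos (EFin \o f z)) ->
  (forall z s, u < z < w -> 0 < s -> is_derive z 1 (f^~ s) (f' z s)) ->
  (forall s, 0 <= G s) -> mu.-integrable Rpos (EFin \o G) ->
  (forall z s, u < z < w -> 0 < s -> `|f' z s| <= G s) ->
  is_derive a 1 (fun z => \int[mu]_(s in Rpos) f z s)
    (\int[mu]_(s in Rpos) f' a s).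
Proof.
move=> auw intf df G0 intG f'G.
have mRpos : measurable Rpos by exact: measurable_itv.
have Ia : `]u, w[%classic a by rewrite /= in_itv.
have intf' z : `]u, w[%classic z -> mu.-integrable Rpos (EFin \o f z).
  by rewrite /= in_itv/=; exact: intf.
have dfE z s : `]u, w[%classic z -> Rpos s ->
    derivable (f^~ s) z 1 /\ partial1of2 f z s = f' z s.
  rewrite /= !in_itv/= andbT => zI s0; have dz := df z s zI s0.
  by split; [have [] := dz|rewrite partial1of2E; exact: derive_val].
have df1 z s : `]u, w[%classic z -> Rpos s -> derivable (f^~ s) z 1.
  by move=> zI s0; have [] := dfE z s zI s0.
have ub z s : `]u, w[%classic z -> Rpos s -> `|partial1of2 f z s| <= G s.
  move=> zI s0; have [_ ->] := dfE z s zI s0.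
  by move: zI s0; rewrite /= !in_itv/= andbT; exact: f'G.
apply: DeriveDef.
  exact: (derivable_under_integral mRpos Ia intf' df1 G0 intG ub).
rewrite -derive1E (differentiation_under_integral mRpos Ia intf' df1 G0 intG ub).
apply: eq_Rintegral => s; rewrite inE => s0.
by have [_ ->] := dfE a s Ia s0.
Qed.

Lemma near_nonzero (x : R) : x != 0 -> \forall z \near x, z != 0.
Proof.
move=> x0; have : open [set z : R | z != 0].
  rewrite (_ : [set z : R | z != 0] = ~` [set z | z = 0]).
    by apply: closed_openC; exact: closed_eq.
  by apply/seteqP; split=> z /eqP.
by rewrite openE => /(_ x x0).
Qed.

Section mixture.
Variables (v : R -> R) (mv : measurable_fun setT v).
Hypothesis iv : mu.-integrable Rpos (EFin \o v).

(** Within |x|/2 of x one has |z| >= |x|/2, so a bound on K' that increases with 1/|z| gives the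
    dominating function |v s| b'(2/|x|). *)
Lemma is_derive_mixture (K K' : R -> R -> R) (b b' : R -> R) (x : R) : x != 0 ->
  (forall s (z : R), z != 0 -> is_derive z 1 (K s) (K' s z)) ->
  (forall z : R, z != 0 -> measurable_fun setT (K ^~ z)) ->
  (forall s (z : R), z != 0 -> `|K s z| <= b `|z|^-1) ->
  (forall s (z : R), z != 0 -> `|K' s z| <= b' `|z|^-1) ->
  (forall y z, 0 <= y -> y <= z -> b' y <= b' z) ->
  is_derive x 1 (fun z => \int[mu]_(s in Rpos) (v s * K s z))
    (\int[mu]_(s in Rpos) (v s * K' s x)).
Proof.
move=> x0 dK mK Kb K'b b'_homo; have nx : 0 < `|x| by rewrite normr_gt0.
have far z : x - `|x| / 2 < z < x + `|x| / 2 -> `|x| / 2 <= `|z|.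
  rewrite -ltr_distl distrC => zx.
  have := ler_normD (x - z) z; rewrite subrK; lra.
have z0 z : x - `|x| / 2 < z < x + `|x| / 2 -> z != 0.
  by move=> /far xz; rewrite -normr_gt0 (lt_le_trans _ xz)// divr_gt0.
(* No sign is assumed on b'; it is inherited from the norm that b' bounds at x, then from
   monotonicity, since 1/|x| <= 2/|x|. *)
have b'0 : 0 <= b' (2 / `|x|).
  apply: le_trans (normr_ge0 (K' 0 x)) (le_trans (K'b _ _ x0) _).
  by apply: b'_homo; rewrite ?invr_ge0// ler_peMl ?invr_ge0// ler1n.
apply: (@is_derive_Rintegral (fun z s => v s * K s z) (fun z s => v s * K' s z)
  (fun s => `|v s| * b' (2 / `|x|)) x (x - `|x| / 2) (x + `|x| / 2)).
- by apply/andP; split; lra.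
- move=> z zI; have Kz s := Kb s z (z0 z zI).
  exact: (integrable_bounded_mul mv iv (mK z (z0 z zI)) Kz).
- move=> z s zI _; have dz := dK s z (z0 z zI).
  by apply: is_derive_eq; rewrite /GRing.scale/=; ring.
- by move=> s; rewrite mulr_ge0.
- have mRpos : measurable Rpos by exact: measurable_itv.
  exact: (integrableZr mRpos (b' (2 / `|x|)) (integrable_norm iv)).
- move=> z s zI _; rewrite normrM ler_wpM2l// (le_trans (K'b _ _ (z0 z zI)))//.
  apply: b'_homo; rewrite ?invr_ge0//.
  have zx := far z zI; have z_gt0 : 0 < `|z| by rewrite normr_gt0 z0.
  by rewrite -[leRHS]invf_div lef_pV2 ?posrE ?divr_gt0.
Qed.

Variable F : R -> R.
Hypothesis FE : forall z : R, z != 0 -> F z = \int[mu]_(s in `]0, +oo[) (v s * qk s z).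

(** A derivative is local, and F coincides with the mixture on a neighbourhood of x that avoids
    0. *)
Lemma is_derive_mixture_qk (x : R) : x != 0 ->
  is_derive x 1 F (\int[mu]_(s in Rpos) (v s * qk_x s x)).
Proof.
move=> x0; apply: (@near_eq_is_derive _ _ _
    (fun z => \int[mu]_(s in Rpos) (v s * qk s z))).
  by apply: filterS (near_nonzero x0) => z z0; rewrite FE.
apply: (@is_derive_mixture qk qk_x id (fun y => y ^+ 2)) => //.
- by move=> s z z0; exact: is_derive_qk_x.
- by move=> z z0; exact: measurable_qk.
- by move=> s z z0; exact: qk_bound.
- by move=> s z z0; rewrite exprVn real_normK ?num_real//; exact: qk_x_bound.
- by move=> y z y0 yz; have z0 := le_trans y0 yz; rewrite lerXn2r.
Qed.

Lemma is_derive2_mixture_qk (x : R) : x != 0 ->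
  is_derive x 1 (derive1 F) (\int[mu]_(s in Rpos) (v s * - qk_ss s x)).
Proof.
move=> x0; apply: (@near_eq_is_derive _ _ _
    (fun z => \int[mu]_(s in Rpos) (v s * qk_x s z))).
  apply: filterS (near_nonzero x0) => z z0; rewrite derive1E.
  by have dz := is_derive_mixture_qk z0; rewrite derive_val.
apply: (@is_derive_mixture qk_x (fun s z => - qk_ss s z) (fun y => y ^+ 2)
  (fun y => 6 * y ^+ 3)) => //.
- by move=> s z z0; exact: is_derive_qk_xx.
- move=> z z0; apply: measurable_funM.
    by apply: measurableT_comp => //; apply: measurable_funM => //; exact: measurable_funM.
  apply: (measurableT_comp (@measurable_invr R)); apply: measurable_funX.
  by apply: measurable_funD => //; exact: measurable_funX.
- by move=> s z z0; rewrite exprVn real_normK ?num_real//; exact: qk_x_bound.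
- by move=> s z z0; rewrite normrN; exact: qk_ss_bound.
- by move=> y z y0 yz; have z0 := le_trans y0 yz; rewrite ler_wpM2l// lerXn2r.
Qed.

Lemma twice_derivable_mixture (x : R) : x != 0 -> twice_derivable F x.
Proof.
move=> x0; split; last by have [] := is_derive2_mixture_qk x0.
apply: filterS (near_nonzero x0) => z z0.
by have [] := is_derive_mixture_qk z0.
Qed.

Lemma derive1n2_mixture (x : R) : x != 0 ->
  derive1n 2 F x = \int[mu]_(s in Rpos) (v s * - qk_ss s x).
Proof.
move=> x0; rewrite /derive1n/= derive1E.
by have dx := is_derive2_mixture_qk x0; exact: derive_val.
Qed.

End mixture.

End derivative_under_integral.

(** * The Gaussian kernel *)

Section heat_kernel.
Context {R : realType}.
Implicit Types s t : R.
Local Notation mu := (@lebesgue_measure R).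
Local Notation Rpos := (`]0%R, +oo[%classic : set (measurableTypeR R)).

Definition heat_s t s : R := - (s / t) * heat t s.
Definition heat_ss t s : R := (s ^+ 2 / t ^+ 2 - t^-1) * heat t s.

Let pi2 : 0 < 2 * pi :> R. Proof. by rewrite mulr_gt0 ?pi_gt0. Qed.

Lemma is_derive_heat_s t s : 0 < t -> is_derive s 1 (heat t) (heat_s t s).
Proof.
move=> t0; have tn0 := lt0r_neq0 t0.
have d1 : is_derive s 1 (fun s => - (s ^+ 2 / (2 * t))) (- (s / t)).
  by apply: is_derive_eq; rewrite /GRing.scale/=; field.
have d2 := is_derive_compl (g := fun s => - (s ^+ 2 / (2 * t)))
  (is_derive_expR _) d1.
have := is_deriveMl d2 (is_derive_cst (Num.sqrt (2 * pi * t))^-1 s 1).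
by move=> /is_derive_eq; apply; rewrite /heat_s /heat /cst/=; ring.
Qed.

Lemma is_derive_heat_ss t s : 0 < t ->
  is_derive s 1 (heat_s t) (heat_ss t s).
Proof.
move=> t0; have tn0 := lt0r_neq0 t0.
have d1 : is_derive s 1 (fun s => - (s / t)) (- t^-1).
  by apply: is_derive_eq; rewrite /GRing.scale/=; ring.
have := is_deriveMl d1 (is_derive_heat_s s t0).
by move=> /is_derive_eq; apply; rewrite /heat_ss /heat_s; field.
Qed.

Lemma is_derive_heat_t t s : 0 < t ->
  is_derive t 1 (heat ^~ s) (2^-1 * heat_ss t s).
Proof.
move=> t0; have tn0 := lt0r_neq0 t0.
have h2 : 2 * t != 0 by rewrite mulf_neq0.
have pt0 : 0 < 2 * pi * t by rewrite mulr_gt0.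
have sq0 : Num.sqrt (2 * pi * t) != 0 by rewrite gt_eqF ?sqrtr_gt0.
have d1 : is_derive t 1 (fun t => - (s ^+ 2 / (2 * t))) (s ^+ 2 / (2 * t ^+ 2)).
  by apply: is_derive_eq; rewrite /GRing.scale/=; field.
have d2 := is_derive_compl (g := fun t => - (s ^+ 2 / (2 * t)))
  (is_derive_expR _) d1.
have d3 : is_derive t 1 (fun t => 2 * pi * t) (2 * pi).
  by apply: is_derive_eq; rewrite /GRing.scale/=; ring.
have d4 := is_derive_compl (g := fun t => 2 * pi * t) (is_derive1_sqrt pt0) d3.
have := is_deriveMl d2 (is_deriveVl (f := fun t => Num.sqrt (2 * pi * t)) sq0 d4).
move=> /is_derive_eq; apply; rewrite /heat_ss /heat.
have E : Num.sqrt (2 * pi * t) ^+ 2 = 2 * pi * t by rewrite sqr_sqrtr// ltW.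
(* With its square eliminated, the root becomes an opaque nonzero atom for [field]. *)
rewrite E; move: (Num.sqrt _) sq0 => q q0.
have pin0 : pi != 0 :> R by rewrite gt_eqF ?pi_gt0.
move: (@pi R) pin0 => p pn0.
by field; rewrite q0 tn0 pn0.
Qed.

(** The exponential grows with the variance, while the ratio of the prefactors is sqrt(t / z) <=
    2. *)
Lemma heat_le_mono z t s : 0 < z -> z <= t -> t <= 4 * z ->
  heat z s <= 2 * heat t s.
Proof.
move=> z0 zt tz; have t0 := lt_le_trans z0 zt.
have q1 : 0 < Num.sqrt (2 * pi * z) by rewrite sqrtr_gt0 mulr_gt0.
have q2 : 0 < Num.sqrt (2 * pi * t) by rewrite sqrtr_gt0 mulr_gt0.
rewrite /heat mulrCA; apply: ler_pM; rewrite ?expR_ge0 ?invr_ge0 ?sqrtr_ge0//.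
  rewrite ler_expR lerN2 ler_wpM2l ?sqr_ge0// lef_pV2 ?posrE ?mulr_gt0//.
  by rewrite ler_pM2l.
rewrite ler_pdivlMr// mulrC ler_pdivrMr// -(@ler_pXn2r _ 2) ?nnegrE ?sqrtr_ge0//.
  have hz : 0 <= 2 * pi * z by rewrite mulr_ge0 ?ltW.
  have ht : 0 <= 2 * pi * t by rewrite mulr_ge0 ?ltW.
  by rewrite exprMn !sqr_sqrtr// mulrCA ler_pM2l//; lra.
Qed.

(** Half of the exponent absorbs the polynomial: u <= exp u with u = s^2 / (4t). What remains is a
    Gaussian of variance 2t, and 8 = 4 * 2 where 2 bounds the ratio sqrt 2 of the prefactors. *)
Lemma sqr_heat_le t s : 0 < t -> s ^+ 2 * heat t s <= 8 * t * heat (2 * t) s.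
Proof.
move=> t0; have tn0 := lt0r_neq0 t0.
have q1 : 0 < Num.sqrt (2 * pi * t) by rewrite sqrtr_gt0 mulr_gt0.
have q2 : 0 < Num.sqrt (2 * pi * (2 * t)) by rewrite sqrtr_gt0 (mulr_gt0 pi2)// mulr_gt0.
have q12 : Num.sqrt (2 * pi * (2 * t)) <= 2 * Num.sqrt (2 * pi * t).
  rewrite -(@ler_pXn2r _ 2) ?nnegrE ?mulr_ge0 ?sqrtr_ge0//.
  have ht : 0 <= 2 * pi * t by rewrite mulr_ge0 ?ltW.
  have h2t : 0 <= 2 * pi * (2 * t) by apply: mulr_ge0; [exact: ltW|rewrite mulr_ge0// ltW].
  by rewrite exprMn !sqr_sqrtr//; lra.
apply: (@le_trans _ _
    (4 * t * expR (- (s ^+ 2 / (2 * (2 * t)))) / Num.sqrt (2 * pi * t))).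
  rewrite /heat mulrA ler_pM2r ?invr_gt0//.
  have -> : - (s ^+ 2 / (2 * t)) = - (s ^+ 2 / (2 * (2 * t))) - s ^+ 2 / (4 * t).
    by field.
  rewrite expRD mulrCA [leRHS]mulrC ler_pM2l ?expR_gt0//.
  rewrite expRN -ler_pdivlMr ?invr_gt0 ?expR_gt0// invrK.
  rewrite [leLHS](_ : _ = 4 * t * (s ^+ 2 / (4 * t))); last by field.
  rewrite ler_pM2l ?mulr_gt0//; have := expR_ge1Dx (s ^+ 2 / (4 * t)); lra.
rewrite /heat (_ : 8 * t * _ = 4 * t * expR (- (s ^+ 2 / (2 * (2 * t)))) *
  (2 / Num.sqrt (2 * pi * (2 * t)))); last by ring.
rewrite ler_wpM2l ?mulr_ge0 ?expR_ge0 ?(ltW t0)//.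
by rewrite ler_pdivlMr// mulrC ler_pdivrMr.
Qed.

Lemma heat_ss_bound t s : 0 < t ->
  `|heat_ss t s| <= 8 * t / t ^+ 2 * heat (2 * t) s + t^-1 * heat t s.
Proof.
move=> t0; rewrite /heat_ss normrM [`|heat _ _|]ger0_norm ?heat_ge0//.
apply: (@le_trans _ _ ((s ^+ 2 / t ^+ 2 + t^-1) * heat t s)).
  rewrite ler_wpM2r ?heat_ge0// (le_trans (ler_normB _ _))//.
  by rewrite !ger0_norm ?invr_ge0 ?divr_ge0 ?sqr_ge0// ltW.
rewrite mulrDl lerD2r mulrAC [leRHS]mulrAC ler_wpM2r ?invr_ge0 ?sqr_ge0//.
exact: sqr_heat_le.
Qed.

Lemma heat_le t s : 0 < t -> heat t s <= (Num.sqrt (2 * pi * t))^-1.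
Proof.
move=> t0; rewrite /heat ler_piMl// ?invr_ge0 ?sqrtr_ge0//.
by rewrite -expR0 ler_expR oppr_le0 divr_ge0 ?sqr_ge0// mulr_ge0// ltW.
Qed.

(** A bound free of z on a window around t. With 1/z <= 2/t and a factor 2 from [heat_le_mono], the
    constants are 16 = 8 * 2 * 2 / 2 and 2 = 2 * 2 / 2. *)
Lemma heat_ss_dominated t z s : 0 < t -> t / 2 < z < 2 * t ->
  `|2^-1 * heat_ss z s| <= 16 / t * heat (4 * t) s + 2 / t * heat (2 * t) s.
Proof.
move=> t0 /andP[z1 z2]; have z0 : 0 < z by lra.
have zt : z^-1 <= 2 / t.
  by rewrite -[leRHS]invf_div lef_pV2 ?posrE ?divr_gt0 ?ltW.
have h1 : heat (2 * z) s <= 2 * heat (4 * t) s by apply: heat_le_mono; lra.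
have h2 : heat z s <= 2 * heat (2 * t) s by apply: heat_le_mono; lra.
have := heat_ss_bound s z0.
have -> : 8 * z / z ^+ 2 = 8 * z^-1 by field; rewrite gt_eqF.
move=> hz; have -> : `|2^-1 * heat_ss z s| = 2^-1 * `|heat_ss z s|.
  by rewrite normrM ger0_norm ?invr_ge0.
have z'0 : 0 <= z^-1 by rewrite invr_ge0 ltW.
have a1 : z^-1 * heat (2 * z) s <= 2 / t * (2 * heat (4 * t) s).
  by apply: ler_pM => //; exact: heat_ge0.
have a2 : z^-1 * heat z s <= 2 / t * (2 * heat (2 * t) s).
  by apply: ler_pM => //; exact: heat_ge0.
by lra.
Qed.

Lemma continuous_heat_ss t : 0 < t -> continuous (heat_ss t).
Proof.
move=> t0 s.
have d1 : is_derive s 1 (fun s => s ^+ 2 / t ^+ 2 - t^-1) (2 * s / t ^+ 2).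
  by apply: is_derive_eq; rewrite /GRing.scale/=; ring.
exact: is_derive_continuous (is_deriveMl d1 (is_derive_heat_s s t0)).
Qed.

Lemma integrable_bounded_heat_ss t (w : R -> R) : 0 < t ->
  measurable_fun setT w -> (exists M, forall s, `|w s| <= M) ->
  mu.-integrable Rpos (fun s => (w s * heat_ss t s)%:E).
Proof.
move=> t0 mw [M wM].
have t20 : 0 < 2 * t by rewrite mulr_gt0.
have mRpos : measurable Rpos by exact: measurable_itv.
have i1 := integrableZl mRpos (M * (8 * t / t ^+ 2)) (integrable_heat t20).
have i2 := integrableZl mRpos (M * t^-1) (integrable_heat t0).
have := integrableD mRpos i1 i2; apply: le_integrable => //.
  apply/measurable_EFinP/measurable_funTS/measurable_funM => //.
  by apply: continuous_measurable_fun; exact: continuous_heat_ss.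
move=> s _; rewrite -!EFinM -EFinD lee_fin/= normrM.
apply: (@le_trans _ _ (M * `|heat_ss t s|)); first by rewrite ler_wpM2r.
apply: le_trans (ler_norm _).
rewrite [leRHS](_ : _ = M * (8 * t / t ^+ 2 * heat (2 * t) s + t^-1 * heat t s)).
  by rewrite ler_wpM2l ?(le_trans _ (wM 0))//; exact: heat_ss_bound.
by ring.
Qed.

Lemma cvgy_bounded_heat t (w : R -> R) : 0 < t -> (exists M, forall s, `|w s| <= M) ->
  w s * heat t s @[s --> +oo] --> 0 /\ w s * heat_s t s @[s --> +oo] --> 0.
Proof.
move=> t0 [M wM]; have t20 : 0 < 2 * t by rewrite mulr_gt0.
have M0 : 0 <= M by apply: le_trans (wM 0).
(* The factor 1 + t dominates both t, needed for [heat], and 1, needed for [heat_s] after division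
   by t. *)
pose c := 8 * (1 + t) * (Num.sqrt (2 * pi * (2 * t)))^-1.
have c0 : 0 <= c by rewrite !mulr_ge0 ?invr_ge0 ?sqrtr_ge0// addr_ge0 ?ltW.
have hP := heat_le _ t20.
have hs s : 1 <= s -> s * heat t s <= t * (8 * (Num.sqrt (2 * pi * (2 * t)))^-1) / s.
  move=> s1; have s0 : 0 < s by lra.
  rewrite ler_pdivlMr// (_ : s * heat t s * s = s ^+ 2 * heat t s); last by ring.
  apply: le_trans (sqr_heat_le s t0) _.
  rewrite [leRHS](_ : _ = 8 * t * (Num.sqrt (2 * pi * (2 * t)))^-1); last by ring.
  by rewrite ler_wpM2l ?hP// mulr_ge0// ltW.
have small e : 0 < e -> \forall s \near +oo, M * c / s <= e /\ 1 <= s.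
  move=> e0; near=> s; have s1 : 1 <= s.
    by near: s; apply: nbhs_pinfty_ge; rewrite num_real.
  have sM : M * c / e <= s by near: s; apply: nbhs_pinfty_ge; rewrite num_real.
  by split=> //; rewrite ler_pdivrMr; [rewrite [leRHS]mulrC -ler_pdivrMr|lra].
split; apply/cvgrPdist_le => e e0; apply: filterS (small e e0) => s [se s1];
  rewrite sub0r normrN normrM; apply: le_trans se; rewrite -mulrA;
  apply: ler_pM => //; have := hs s s1; have := heat_ge0 t s;
  have s0 : 0 < s by lra.
- move=> h0 h1; rewrite ger0_norm//.
  have h2 : heat t s <= s * heat t s by rewrite ler_peMl.
  apply: (le_trans h2 (le_trans h1 _)).
  rewrite /c; set p := (Num.sqrt _)^-1.
  have p0 : 0 <= p / s by rewrite divr_ge0 ?invr_ge0 ?sqrtr_ge0 ?(ltW s0).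
  rewrite [leLHS](_ : _ = 8 * t * (p / s)); last by rewrite /p; ring.
  rewrite [leRHS](_ : _ = 8 * (1 + t) * (p / s)); last by rewrite /p; ring.
  by rewrite ler_wpM2r//; lra.
- move=> h0 h1; rewrite /heat_s normrM normrN !ger0_norm ?divr_ge0 ?(ltW s0) ?(ltW t0)//.
  rewrite mulrAC ler_pdivrMr//; apply: (le_trans h1).
  rewrite /c; set p := (Num.sqrt _)^-1.
  have p0 : 0 <= p / s by rewrite divr_ge0 ?invr_ge0 ?sqrtr_ge0 ?(ltW s0).
  rewrite [leLHS](_ : _ = 8 * t * (p / s)); last by rewrite /p; ring.
  rewrite [leRHS](_ : _ = 8 * (1 + t) * t * (p / s)); last by rewrite /p; ring.
  by rewrite ler_wpM2r//; nra.
Unshelve. all: end_near. Qed.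

End heat_kernel.

(** * An algebra of weights in s *)

Section bounded_continuous.
Context {R : realType}.

(** This class is stable under sums and products, contains the kernels and their s-derivatives, and
    implies integrability against the Gaussian. *)
Definition bounded_continuous (f : R -> R) :=
  continuous f /\ exists M, forall s, `|f s| <= M.

Lemma bounded_continuous_cst (a : R) : bounded_continuous (fun=> a).
Proof. by split; [move=> s; exact: cvg_cst|exists `|a|]. Qed.

Lemma bounded_continuousD f g : bounded_continuous f -> bounded_continuous g ->
  bounded_continuous (fun s => f s + g s).
Proof.
move=> [cf [M fM]] [cg [N gN]]; split.
  by move=> s; apply: cvgD; [exact: cf|exact: cg].
exists (M + N) => s; rewrite (le_trans (ler_normD _ _))//.
exact: lerD.
Qed.

Lemma bounded_continuousM f g : bounded_continuous f -> bounded_continuous g ->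
  bounded_continuous (fun s => f s * g s).
Proof.
move=> [cf [M fM]] [cg [N gN]]; split.
  by move=> s; apply: cvgM; [exact: cf|exact: cg].
by exists (M * N) => s; rewrite normrM ler_pM.
Qed.

Lemma bounded_continuous_sum I (r : seq I) (A : pred I) (f : I -> R -> R) :
  (forall i, A i -> bounded_continuous (f i)) ->
  bounded_continuous (fun s => \sum_(i <- r | A i) f i s).
Proof.
move=> bf; elim: r => [|i r IH].
  by under eq_fun do rewrite big_nil; exact: bounded_continuous_cst.
case Ai: (A i); under eq_fun do rewrite big_cons Ai; last exact: IH.
by apply: bounded_continuousD => //; exact: bf.
Qed.

Lemma bounded_continuous_prod I (r : seq I) (A : pred I) (f : I -> R -> R) :
  (forall i, A i -> bounded_continuous (f i)) ->
  bounded_continuous (fun s => \prod_(i <- r | A i) f i s).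
Proof.
move=> bf; elim: r => [|i r IH].
  by under eq_fun do rewrite big_nil; exact: bounded_continuous_cst.
case Ai: (A i); under eq_fun do rewrite big_cons Ai; last exact: IH.
by apply: bounded_continuousM => //; exact: bf.
Qed.

Lemma bounded_continuous_measurable f : bounded_continuous f -> measurable_fun setT f.
Proof. by move=> [cf _]; exact: continuous_measurable_fun. Qed.

Lemma bounded_continuous_qk (x : R) : x != 0 -> bounded_continuous (qk ^~ x).
Proof.
move=> x0; split; last by exists `|x|^-1 => s; exact: qk_bound.
by move=> s; exact: is_derive_continuous (is_derive_qk_s s x0).
Qed.

Lemma bounded_continuous_qk_s (x : R) : x != 0 -> bounded_continuous (qk_s ^~ x).
Proof.
move=> x0; split; last by exists (x ^+ 2)^-1 => s; exact: qk_s_bound.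
by move=> s; exact: is_derive_continuous (is_derive_qk_ss s x0).
Qed.

Lemma bounded_continuous_qk_ss (x : R) : x != 0 -> bounded_continuous (qk_ss ^~ x).
Proof.
move=> x0; split; last by exists (6 * `|x|^-1 ^+ 3) => s; exact: qk_ss_bound.
move=> s; have D0 : s ^+ 2 + x ^+ 2 != 0 by rewrite gt_eqF ?denom_gt0.
have D30 : (s ^+ 2 + x ^+ 2) ^+ 3 != 0 by rewrite expf_neq0.
apply: (@is_derive_continuous _ _ _ ('D_1 (qk_ss ^~ x) s)).
by apply: DeriveDef => //; apply: ex_derive.
Qed.

Lemma is_derive_big_sum (I : Type) (r : seq I) (A : pred I)
    (f : I -> R -> R) (f' : I -> R) (s : R) :
  (forall i, A i -> is_derive s 1 (f i) (f' i)) ->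
  is_derive s 1 (fun s => \sum_(i <- r | A i) f i s) (\sum_(i <- r | A i) f' i).
Proof.
move=> df; elim: r => [|i r IH].
  by under eq_fun do rewrite big_nil; rewrite big_nil; exact: is_derive_cst.
case Ai: (A i); under eq_fun do rewrite big_cons Ai; rewrite big_cons Ai.
  exact: is_deriveDl (df i Ai) IH.
exact: IH.
Qed.

(** Leibniz rule; [uniq] matters because the condition i != k would delete every occurrence of k. *)
Lemma is_derive_big_prod (I : eqType) (r : seq I) (A : pred I)
    (f : I -> R -> R) (f' : I -> R) (s : R) : uniq r ->
  (forall i, A i -> is_derive s 1 (f i) (f' i)) ->
  is_derive s 1 (fun s => \prod_(i <- r | A i) f i s)
    (\sum_(k <- r | A k) f' k * \prod_(i <- r | A i && (i != k)) f i s).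
Proof.
move=> + df; elim: r => [_|i r IH /= /andP[ir ur]].
  by under eq_fun do rewrite big_nil; rewrite big_nil; exact: is_derive_cst.
have {}IH := IH ur.
(* Differentiating a factor of the tail keeps the head factor; differentiating the head removes
   nothing from the tail, since i is not in r. *)
have tailE k : k \in r ->
    \prod_(j <- i :: r | A j && (j != k)) f j s =
    (if A i then f i s else 1) * \prod_(j <- r | A j && (j != k)) f j s.
  move=> kr; rewrite big_cons; have -> : i != k.
    by apply: contraNneq ir => ->.
  by rewrite andbT; case: ifP; rewrite ?mul1r.
have headE : \prod_(j <- i :: r | A j && (j != i)) f j s = \prod_(j <- r | A j) f j s.
  rewrite big_cons eqxx andbF big_seq_cond [RHS]big_seq_cond.
  apply: eq_bigl => j; case: (boolP (j \in r)) => //= jr.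
  by rewrite (_ : j != i) ?andbT//; apply: contraNneq ir => <-.
rewrite big_cons headE.
have -> : \sum_(k <- r | A k) f' k * \prod_(j <- i :: r | A j && (j != k)) f j s =
    (if A i then f i s else 1) *
    \sum_(k <- r | A k) f' k * \prod_(j <- r | A j && (j != k)) f j s.
  rewrite big_distrr/= big_seq_cond [RHS]big_seq_cond.
  by apply: eq_bigr => k /andP[kr _]; rewrite tailE// mulrCA.
case Ai: (A i); under eq_fun do rewrite big_cons Ai; last by rewrite mul1r.
by apply: is_derive_eq (is_deriveMl (df i Ai) IH) _.
Qed.

End bounded_continuous.

(** * Moving derivatives from the Gaussian to the weight *)

Section heat_integration.
Context {R : realType}.
Implicit Types s t : R.
Local Notation mu := (@lebesgue_measure R).
Local Notation Rpos := (`]0%R, +oo[%classic : set (measurableTypeR R)).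

Lemma is_derive_heat_integral t (w : R -> R) : 0 < t -> bounded_continuous w ->
  is_derive t 1 (fun z => \int[mu]_(s in Rpos) (w s * heat z s))
    (\int[mu]_(s in Rpos) (w s * (2^-1 * heat_ss t s))).
Proof.
move=> t0 bw; have mw := bounded_continuous_measurable bw; have [_ [M wM]] := bw.
have M0 : 0 <= M by apply: le_trans (wM 0).
have t20 : 0 < 2 * t by rewrite mulr_gt0.
have t40 : 0 < 4 * t by rewrite mulr_gt0.
have mRpos : measurable Rpos by exact: measurable_itv.
apply: (@is_derive_Rintegral _ (fun z s => w s * heat z s)
  (fun z s => w s * (2^-1 * heat_ss z s))
  (fun s => M * (16 / t) * heat (4 * t) s + M * (2 / t) * heat (2 * t) s)
  t (t / 2) (2 * t)).
- by apply/andP; split; lra.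
- move=> z /andP[z1 z2]; apply: integrable_bounded_heat => //; last by exists M.
  by lra.
- move=> z s /andP[z1 z2] _; have z0 : 0 < z by lra.
  have dz := is_deriveMl (is_derive_cst (w s) z 1) (is_derive_heat_t s z0).
  by apply: is_derive_eq dz _; rewrite mul0r add0r.
- move=> s; rewrite addr_ge0// !mulr_ge0 ?heat_ge0 ?invr_ge0// ltW//.
- exact: (integrableD mRpos (integrableZl mRpos (M * (16 / t)) (integrable_heat t40))
    (integrableZl mRpos (M * (2 / t)) (integrable_heat t20))).
- move=> z s zI _; rewrite normrM -!mulrA -mulrDr; apply: ler_pM => //.
  by have := heat_ss_dominated s t0 zI; rewrite -!mulrA.
Qed.

(** Both integrations by parts at once: Q'' g - Q g'' is the derivative of Q' g - Q g', which
    vanishes at 0 by hypothesis and at infinity by Gaussian decay. *)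
Lemma heat_integration_by_parts t (Q Q1 Q2 : R -> R) : 0 < t ->
  (forall s, is_derive s 1 Q (Q1 s)) -> (forall s, is_derive s 1 Q1 (Q2 s)) ->
  bounded_continuous Q -> bounded_continuous Q1 -> bounded_continuous Q2 ->
  Q 0 = 0 -> Q1 0 = 0 ->
  \int[mu]_(s in `]0, +oo[) (Q s * heat_ss t s) =
  \int[mu]_(s in `]0, +oo[) (Q2 s * heat t s).
Proof.
move=> t0 dQ dQ1 bQ bQ1 bQ2 Q0 Q10.
have mRpos : measurable Rpos by exact: measurable_itv.
pose H s := Q1 s * heat t s - Q s * heat_s t s.
have dH (s : R) : is_derive s 1 H (Q2 s * heat t s - Q s * heat_ss t s).
  have h1 := is_deriveMl (dQ1 s) (is_derive_heat_s s t0).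
  have h2 := is_deriveMl (dQ s) (is_derive_heat_ss s t0).
  by apply: is_derive_eq (is_deriveDl h1 (is_deriveNl h2)) _; ring.
have i1 : mu.-integrable Rpos (EFin \o (fun s => Q2 s * heat t s)).
  apply: integrable_bounded_heat => //; first exact: bounded_continuous_measurable.
  by have [] := bQ2.
have i2 : mu.-integrable Rpos (EFin \o (fun s => Q s * heat_ss t s)).
  apply: integrable_bounded_heat_ss => //; first exact: bounded_continuous_measurable.
  by have [] := bQ.
have cH : continuous (fun s => Q2 s * heat t s - Q s * heat_ss t s).
  move=> s; apply: cvgB; apply: cvgM.
  - by have [+ _] := bQ2; exact.
  - exact: is_derive_continuous (is_derive_heat_s s t0).
  - by have [+ _] := bQ; exact.
  - exact: continuous_heat_ss.
have lim : H s @[s --> +oo] --> 0.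
  rewrite -[X in _ --> X](subrr 0); apply: cvgB.
    by have [] := cvgy_bounded_heat t0 bQ1.2.
  by have [] := cvgy_bounded_heat t0 bQ.2.
have := integrable_continuous_FTC2y cH dH (integrableB mRpos i1 i2) lim.
rewrite RintegralB// /H Q0 Q10 !mul0r subrr subr0 => /eqP.
by rewrite subr_eq0 => /eqP ->.
Qed.

End heat_integration.

(** * The fractional equation *)

Section measurable_mixture.
Context {R : realType}.
Local Notation mu := (@lebesgue_measure R).
Local Notation Rpos := (`]0%R, +oo[%classic : set (measurableTypeR R)).

(** F is continuous off 0, being differentiable there, and any function is measurable on a single
    point. *)
Lemma measurable_mixture (v F : R -> R) : measurable_fun setT v ->
  mu.-integrable Rpos (EFin \o v) ->
  (forall z, z != 0 -> F z = \int[mu]_(s in `]0, +oo[) (v s * qk s z)) ->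
  measurable_fun setT F.
Proof.
move=> mv iv FE; rewrite -(@setvU _ [set (0 : R)]); apply/measurable_funU => //.
  exact: measurableC.
split; last exact: measurable_fun_set1.
apply: open_continuous_measurable_fun.
  by apply: closed_openC; exact: closed_eq.
move=> x; rewrite inE /= => /eqP x0.
exact: is_derive_continuous (is_derive_mixture_qk mv iv FE x0).
Qed.

End measurable_mixture.

(** * Spatial derivatives of the density and the heat equation *)

Section equation.
Context {R : realType} {d : nat}.
Local Notation mu := (@lebesgue_measure R).
Local Notation Rpos := (`]0%R, +oo[%classic : set (measurableTypeR R)).
Variables (t : R) (t0 : 0 < t).
Implicit Types (x : 'rV[R]_d) (k j : 'I_d).

Local Notation cd := (2 / pi ^+ d : R).
Local Notation p := (fun x : 'rV[R]_d => p_CB x t).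

Definition prod_qk (A : pred 'I_d) x (s : R) : R := \prod_(i | A i) qk s (x 0 i).

Let bounded_prod_qk (A : pred 'I_d) x : (forall i, A i -> x 0 i != 0) ->
  bounded_continuous (prod_qk A x).
Proof.
by move=> x0; apply: bounded_continuous_prod => i Ai; exact/bounded_continuous_qk/x0.
Qed.

Lemma integrable_bc_heat (w : R -> R) : bounded_continuous w ->
  mu.-integrable Rpos (EFin \o (fun s => w s * heat t s)).
Proof.
move=> bw; apply: integrable_bounded_heat => //.
  exact: bounded_continuous_measurable.
by have [] := bw.
Qed.

Lemma measurable_bc_heat (w : R -> R) : bounded_continuous w ->
  measurable_fun setT (fun s => w s * heat t s).
Proof.
move=> bw; apply: measurable_funM; last exact: measurable_heat.
exact: bounded_continuous_measurable.
Qed.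

Lemma set_coord_neq0 x k (y : R) (A : pred 'I_d) : y != 0 ->
  (forall i, A i -> i != k -> x 0 i != 0) ->
  forall i, A i -> set_coord x k y 0 i != 0.
Proof. by move=> y0 x0 i Ai; rewrite mxE; case: (eqVneq i k) => // ik; apply: x0. Qed.

Lemma prod_qk_set_coord (A : pred 'I_d) x k (y s : R) : A k ->
  prod_qk A (set_coord x k y) s =
  qk s y * prod_qk (fun i => A i && (i != k)) x s.
Proof.
move=> Ak; rewrite /prod_qk (bigD1 k)//= mxE eqxx; congr (_ * _).
by apply: eq_bigr => i /andP[_ /negPf ik]; rewrite mxE ik.
Qed.

Lemma p_CBE x : p_CB x t = cd * \int[mu]_(s in `]0, +oo[) (prod_qk predT x s * heat t s).
Proof. by []. Qed.

(** Casts the density, seen along one coordinate, as a mixture of [qk]: the other coordinates and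
    the Gaussian are absorbed in the weight. *)
Lemma along_p_CB x k (y : R) : (forall i, i != k -> x 0 i != 0) -> y != 0 ->
  along p k x y = \int[mu]_(s in `]0, +oo[)
    (cd * prod_qk (predC1 k) x s * heat t s * qk s y).
Proof.
move=> x0 y0; have mRpos : measurable Rpos by exact: measurable_itv.
rewrite /along p_CBE -RintegralZl//.
  by apply: eq_Rintegral => s _; rewrite prod_qk_set_coord//; ring.
apply: integrable_bc_heat; apply: bounded_prod_qk.
by apply: set_coord_neq0 => // i _; exact: x0.
Qed.

Let bc_scale (a : R) w : bounded_continuous w -> bounded_continuous (fun s => a * w s).
Proof. by move=> bw; apply: bounded_continuousM => //; exact: bounded_continuous_cst. Qed.

Section first_order.
Variables (x : 'rV[R]_d) (k : 'I_d).
Hypothesis x0 : forall i, x 0 i != 0.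

Let v s := cd * prod_qk (predC1 k) x s * heat t s.

Let bc : bounded_continuous (fun s => cd * prod_qk (predC1 k) x s).
Proof. by apply: bc_scale; apply: bounded_prod_qk. Qed.

Let mv : measurable_fun setT v. Proof. exact: measurable_bc_heat bc. Qed.
Let iv : mu.-integrable Rpos (EFin \o v). Proof. exact: integrable_bc_heat bc. Qed.
Let FE (y : R) : y != 0 -> along p k x y = \int[mu]_(s in `]0, +oo[) (v s * qk s y).
Proof. by move=> y0; rewrite along_p_CB. Qed.
Let mF : measurable_fun setT (along p k x).
Proof. exact: measurable_mixture mv iv FE. Qed.

Lemma riesz_derivable_p_CB : riesz_derivable (along p k x) (x 0 k).
Proof. exact: riesz_derivable_mixture mv iv mF (x0 k) FE. Qed.

Lemma partial_riesz_p_CB : partial_riesz k p x =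
  \int[mu]_(s in `]0, +oo[) (v s * - qk_s s (x 0 k)).
Proof. exact: riesz_derivative_mixture mv iv mF (x0 k) FE. Qed.

Lemma twice_derivable_p_CB : twice_derivable (along p k x) (x 0 k).
Proof. exact (twice_derivable_mixture mv iv FE (x0 k)). Qed.

Lemma partial2_p_CB : partial2 k p x =
  \int[mu]_(s in `]0, +oo[) (v s * - qk_ss s (x 0 k)).
Proof. exact (derive1n2_mixture mv iv FE (x0 k)). Qed.

End first_order.

Section second_order.
Variables (x : 'rV[R]_d) (k j : 'I_d).
Hypotheses (x0 : forall i, x 0 i != 0) (jk : j != k).

(** After a Riesz derivative in x_j the function is again a mixture of [qk] along x_k, with this new
    weight, so the same lemmas apply a second time. *)
Let v s := cd * prod_qk (fun i => (i != j) && (i != k)) x s * - qk_s s (x 0 j) * heat t s.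

Let bc : bounded_continuous (fun s =>
  cd * prod_qk (fun i => (i != j) && (i != k)) x s * - qk_s s (x 0 j)).
Proof.
apply: bounded_continuousM; first by apply: bc_scale; apply: bounded_prod_qk.
rewrite (_ : (fun s => _) = fun s => -1 * qk_s s (x 0 j)).
  exact/bc_scale/bounded_continuous_qk_s.
by apply/funext => s; rewrite mulN1r.
Qed.

Let mv : measurable_fun setT v. Proof. exact: measurable_bc_heat bc. Qed.
Let iv : mu.-integrable Rpos (EFin \o v). Proof. exact: integrable_bc_heat bc. Qed.
Let FE (y : R) : y != 0 -> along (partial_riesz j p) k x y =
  \int[mu]_(s in `]0, +oo[) (v s * qk s y).
Proof.
move=> y0; rewrite /along partial_riesz_p_CB; last first.
  by move=> i; apply: (@set_coord_neq0 _ _ _ predT).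
apply: eq_Rintegral => s _; rewrite prod_qk_set_coord/=; last by rewrite eq_sym.
by rewrite mxE (negPf jk) /v; ring.
Qed.
Let mF : measurable_fun setT (along (partial_riesz j p) k x).
Proof. exact: measurable_mixture mv iv FE. Qed.

Lemma riesz_derivable2_p_CB :
  riesz_derivable (along (partial_riesz j p) k x) (x 0 k).
Proof. exact: riesz_derivable_mixture mv iv mF (x0 k) FE. Qed.

Lemma partial_riesz2_p_CB : partial_riesz k (partial_riesz j p) x =
  \int[mu]_(s in `]0, +oo[) (v s * - qk_s s (x 0 k)).
Proof. exact: riesz_derivative_mixture mv iv mF (x0 k) FE. Qed.

End second_order.

Lemma heat_integral_sum (I : finType) (A : pred I) (w : I -> R -> R) :
  (forall i, bounded_continuous (w i)) ->
  \int[mu]_(s in `]0, +oo[) ((\sum_(i | A i) w i s) * heat t s) =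
  \sum_(i | A i) \int[mu]_(s in `]0, +oo[) (w i s * heat t s).
Proof.
move=> bw; have mRpos : measurable Rpos by exact: measurable_itv.
elim: (index_enum I) => [|i r IH].
  rewrite big_nil; under eq_Rintegral do rewrite big_nil mul0r.
  by rewrite /Rintegral integral0.
rewrite big_cons; case Ai: (A i); last first.
  by under eq_Rintegral do rewrite big_cons Ai.
under eq_Rintegral do rewrite big_cons Ai mulrDl.
rewrite RintegralD// ?IH//; first exact: integrable_bc_heat.
by apply: integrable_bc_heat; apply: bounded_continuous_sum => l _.
Qed.

Section heat_equation.
Variable x : 'rV[R]_d.
Hypotheses (x0 : forall i, x 0 i != 0) (d1 : (1 < d)%N).

(** The second derivative of Q splits into diagonal terms [u k], to be matched with [partial2], and
    off-diagonal terms [w2 k l], to be matched with the mixed Riesz derivatives. *)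
Let Q := prod_qk predT x.
Let w1 k s := qk_s s (x 0 k) * prod_qk (predC1 k) x s.
Let w2 k l s := qk_s s (x 0 k) *
  (qk_s s (x 0 l) * prod_qk (fun i => (i != k) && (i != l)) x s).
Let u k s := qk_ss s (x 0 k) * prod_qk (predC1 k) x s.
Let Q2 s := \sum_k (u k s + \sum_(l | l != k) w2 k l s).

Let dQ (s : R) : is_derive s 1 Q (\sum_k w1 k s).
Proof.
have := @is_derive_big_prod R _ (index_enum 'I_d) predT (fun i => qk ^~ (x 0 i))
  (fun i => qk_s s (x 0 i)) s (index_enum_uniq _)
  (fun i _ => is_derive_qk_s s (x0 i)).
by [].
Qed.

Let dQ1 (s : R) : is_derive s 1 (fun s => \sum_k w1 k s) (Q2 s).
Proof.
apply: is_derive_big_sum => k _.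
have h := @is_derive_big_prod R _ (index_enum 'I_d) (predC1 k) (fun i => qk ^~ (x 0 i))
  (fun i => qk_s s (x 0 i)) s (index_enum_uniq _)
  (fun i _ => is_derive_qk_s s (x0 i)).
apply: is_derive_eq (is_deriveMl (is_derive_qk_ss s (x0 k)) h) _.
by rewrite /u /w2 big_distrr.
Qed.

Let bu k : bounded_continuous (u k).
Proof.
by apply: bounded_continuousM; [exact: bounded_continuous_qk_ss|exact: bounded_prod_qk].
Qed.

Let bw1 k : bounded_continuous (w1 k).
Proof.
by apply: bounded_continuousM; [exact: bounded_continuous_qk_s|exact: bounded_prod_qk].
Qed.

Let bw2 k l : bounded_continuous (w2 k l).
Proof.
apply: bounded_continuousM; first exact: bounded_continuous_qk_s.
by apply: bounded_continuousM; [exact: bounded_continuous_qk_s|exact: bounded_prod_qk].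
Qed.

Let bsw2 k : bounded_continuous (fun s => \sum_(l | l != k) w2 k l s).
Proof. by apply: bounded_continuous_sum. Qed.

Let bQ2k k : bounded_continuous (fun s => u k s + \sum_(l | l != k) w2 k l s).
Proof. exact: bounded_continuousD. Qed.

Let qk0 (y : R) : qk 0 y = 0. Proof. by rewrite /qk mul0r. Qed.

Let prod_qk0 (A : pred 'I_d) i : A i -> prod_qk A x 0 = 0.
Proof. by move=> Ai; rewrite /prod_qk (bigD1 i)//= qk0 mul0r. Qed.

Let J w := \int[mu]_(s in `]0, +oo[) (w s * heat t s).

Lemma time_derivative_p_CB : is_derive t 1 (p_CB x) (cd * (2^-1 *
  \sum_k (J (u k) + \sum_(l | l != k) J (w2 k l)))).
Proof.
have mRpos : measurable Rpos by exact: measurable_itv.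
have bQ : bounded_continuous Q by exact: bounded_prod_qk.
have h := is_derive_heat_integral t0 bQ.
apply: is_derive_eq (is_deriveMl (is_derive_cst cd t 1) h) _.
rewrite mul0r add0r; congr (_ * _).
transitivity (\int[mu]_(s in Rpos) (2^-1 * (Q s * heat_ss t s))).
  by apply: eq_Rintegral => s _; ring.
rewrite RintegralZl//; last first.
  apply: integrable_bounded_heat_ss => //; first exact: bounded_continuous_measurable.
  by have [] := bQ.
congr (_ * _).
have i0 : 'I_d by exact: (Ordinal (ltnW d1)).
(* This is where d > 1 enters: each term of Q' keeps a factor [qk] of another coordinate, which
   vanishes at s = 0. *)
have neq k : exists l, l != k.
  have [k0|k0] := eqVneq (k : nat) 0%N.
    by exists (Ordinal d1); apply/eqP => /(congr1 val)/=; rewrite k0.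
  by exists (Ordinal (ltnW d1)); apply: contra_neq k0 => <-.
have bW1 : bounded_continuous (fun s => \sum_k w1 k s) by exact: bounded_continuous_sum.
have bQ2 : bounded_continuous Q2 by exact: bounded_continuous_sum.
have Q0 : Q 0 = 0 by exact: (prod_qk0 (i := i0)).
have W10 : \sum_k w1 k 0 = 0.
  by apply: big1 => k _; have [l lk] := neq k; rewrite /w1 (@prod_qk0 _ l)// mulr0.
transitivity (J Q2); first exact: heat_integration_by_parts t0 dQ dQ1 bQ bW1 bQ2 Q0 W10.
rewrite /J heat_integral_sum//; apply: eq_bigr => k _.
under eq_Rintegral do rewrite mulrDl.
rewrite RintegralD//; [|exact: integrable_bc_heat|exact: integrable_bc_heat].
by rewrite heat_integral_sum.
Qed.

Lemma fractional_heat_equation : derive1 (p_CB x) t =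
  2^-1 * (2 * (\sum_(k < d) \sum_(j < d | (j < k)%N)
      partial_riesz k (partial_riesz j p) x) - \sum_(k < d) partial2 k p x).
Proof.
have mRpos : measurable Rpos by exact: measurable_itv.
have dt := time_derivative_p_CB; rewrite derive1E derive_val.
(* The minus sign of harmonicity survives here, while the two minus signs of the Riesz derivatives
   cancel in [RR]. *)
have P2 k : partial2 k p x = - (cd * J (u k)).
  rewrite partial2_p_CB// /J -mulNr -RintegralZl//; last exact: integrable_bc_heat.
  by apply: eq_Rintegral => s _; rewrite /u; ring.
have RR k j : j != k -> partial_riesz k (partial_riesz j p) x = cd * J (w2 k j).
  move=> jk; rewrite partial_riesz2_p_CB// /J -RintegralZl//; last exact: integrable_bc_heat.
  apply: eq_Rintegral => s _; rewrite /w2 /prod_qk.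
  by under [in RHS]eq_bigl do rewrite andbC; ring.
have w2C k l : J (w2 k l) = J (w2 l k).
  apply: eq_Rintegral => s _; congr (_ * _); rewrite /w2 mulrCA.
  by congr (_ * (_ * _)); apply: eq_bigl => i; rewrite andbC.
(* By symmetry in the two indices the off-diagonal sum is twice its part below the diagonal, whence
   the coefficient 2 of the equation. *)
have sumw : \sum_k \sum_(l | l != k) J (w2 k l) =
    2 * \sum_(k < d) \sum_(l < d | (l < k)%N) J (w2 k l).
  transitivity (\sum_(k < d) (\sum_(l < d | (l < k)%N) J (w2 k l) +
      \sum_(l < d | (k < l)%N) J (w2 k l))).
    apply: eq_bigr => k _; rewrite (bigID (fun l : 'I_d => (l < k)%N))/=.
    congr (_ + _); apply: eq_bigl => l; rewrite -val_eqE/=; lia.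
  rewrite big_split/= [X in _ + X](_ : _ =
      \sum_(k < d) \sum_(l < d | (l < k)%N) J (w2 k l)); first by ring.
  rewrite (exchange_big_dep predT)//=; apply: eq_bigr => k _.
  by apply: eq_bigr => l _; exact: w2C.
have -> : \sum_(k < d) \sum_(j < d | (j < k)%N) partial_riesz k (partial_riesz j p) x =
    cd * \sum_(k < d) \sum_(l < d | (l < k)%N) J (w2 k l).
  rewrite big_distrr/=; apply: eq_bigr => k _; rewrite big_distrr/=.
  by apply: eq_bigr => j jk; rewrite RR// neq_ltn jk.
under [X in _ - X]eq_bigr do rewrite P2.
rewrite sumrN -big_distrr/= big_split/= sumw.
ring.
Qed.

End heat_equation.

End equation.

Unset Implicit Arguments.

(* The factor 2^-1 is forced by the normalisation of the Gaussian kernel,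
   g_t = g_ss / 2, and the equation is pointwise off the coordinate hyperplanes,
   on which p_CB is singular. *)
Theorem theorem3p5 (R : realType) (dOm : measure_display)
  (Om : measurableType dOm) (P : probability Om R) (d : nat) (hd : (0 < d)%N)
  (C : 'I_d -> R -> Om -> R) (B : R -> Om -> R)
  (hC : forall j, standard_cauchy_process P (C j))
  (hB : standard_brownian_motion P B)
  (hind : independent_processes P (oapp C B)) :
  (forall t : R, 0 < t ->
     has_density P (fun w => \row_j C j `|B t w| w) (p_CB ^~ t)) /\
  ((1 < d)%N ->
     (forall (x : 'rV[R]_d) (t : R), (forall j, x 0 j != 0) -> 0 < t ->
        let p := p_CB ^~ t in
        [/\ derivable (p_CB x) t 1,
            (forall k, twice_derivable (along p k x) (x 0 k)),
            (forall j, riesz_derivable (along p j x) (x 0 j)),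
            (forall k j : 'I_d, (j < k)%N ->
               riesz_derivable (along (partial_riesz j p) k x) (x 0 k)) &
            derive1 (p_CB x) t =
              2^-1 * (2 * (\sum_(k < d) \sum_(j < d | (j < k)%N)
                             partial_riesz k (partial_riesz j p) x)
                      - \sum_(k < d) partial2 k p x)]) /\
     (forall phi : 'rV[R]_d -> R, continuous phi ->
        (exists M : R, forall x, `|phi x| <= M) ->
        rv_integral (fun x => (phi x * p_CB x t)%:E) @[t --> 0^'+]
          --> (phi 0)%:E)).
Proof.
split; first by move=> t t0; exact (subordinated_density hC hB hind t0).
move=> d1; split; last first.
  by move=> phi cphi bphi; exact (subordinated_initial hC hB hind cphi bphi).
move=> x t x0 t0 p; split.
- by have [] := time_derivative_p_CB t0 x0 d1.
- by move=> k; exact: twice_derivable_p_CB.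
- by move=> j; exact: riesz_derivable_p_CB.
- by move=> k j jk; apply: riesz_derivable2_p_CB => //; rewrite neq_ltn jk.
- exact: fractional_heat_equation.
Qed.
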